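(* Let $\mathcal H$ be a separable Hilbert space, let $\{\Phi(\cdot),\Psi(\cdot)\}$ be a Nevanlinna pair in $\mathcal H$ and let $\mathcal F(\cdot)\in\widetilde R(\mathcal H)$ be the corresponding Nevanlinna family. Let $z_0\in\mathbb C_+$ and let $a\in\mathbb R$. Then the following statements hold: (i) if $0\in\sigma_p(\mathsf N_{\Phi,\Psi}(z_0,z_0))$, then $0\in\sigma_p(\mathsf N_{\Phi,\Psi}(z,z))$ for all $z\in\mathbb C\setminus\mathbb R$; (ii) if $0\in\sigma_c(\mathsf N_{\Phi,\Psi}(z_0,z_0))$, then $0\in\sigma_c(\mathsf N_{\Phi,\Psi}(z,z))$ for all $z\in\mathbb C\setminus\mathbb R$; (iii) if $0\in\rho(\mathsf N_{\Phi,\Psi}(z_0,z_0))$, then $0\in\rho(\mathsf N_{\Phi,\Psi}(z,z))$ for all $z\in\mathbb C\setminus\mathbb R$; (iv) if $a\in\sigma_p(\mathcal F(z_0))$, then $a\in\sigma_p(\mathcal F(z))$ for all $z\in\mathbb C\setminus\mathbb R$, and in this case $\ker(\mathcal F(z)-a)=\ker(\mathcal F(z_0)-a)$; (v) if $a\in\sigma_c(\mathcal F(z_0))$, then $a\in\sigma_c(\mathcal F(z))$ for all $z\in\mathbb C\setminus\mathbb R$; (vi) if $a\in\rho(\mathcal F(z_0))$, then $a\in\rho(\mathcal F(z))$ for all $z\in\mathbb C\setminus\mathbb R$; (vii) if $\mathcal F(z_0)\in\mathcal B(\mathcal H)$, then $\mathcal F(z)\in\mathcal B(\mathcal H)$ for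 all $z\in\mathbb C\setminus\mathbb R$; (viii) $\operatorname{mul}\mathcal F(z)$ does not depend on $z\in\mathbb C\setminus\mathbb R$.
   Context: $\mathcal B(\mathcal H)$: bounded everywhere defined operators on $\mathcal H$; operators are identified with their graphs. A linear relation $T$ in $\mathcal H$ is a linear subspace of $\mathcal H\times\mathcal H$; $\operatorname{dom}T,\operatorname{ran}T$ are the sets of first/second components, $\ker T=\{f:\{f,0\}\in T\}$, $\operatorname{mul}T=\{g:\{0,g\}\in T\}$, $T-a=\{\{f,g-af\}:\{f,g\}\in T\}$, $T^{-1}=\{\{g,f\}:\{f,g\}\in T\}$, and $T^*=\{\{h,k\}:(k,f)=(h,g)\text{ for all }\{f,g\}\in T\}$. For a closed relation $T$: $a\in\sigma_p(T)$ iff $\ker(T-a)\ne\{0\}$; $a\in\rho(T)$ iff $(T-a)^{-1}\in\mathcal B(\mathcal H)$; $a\in\sigma_c(T)$ iff $\ker(T-a)=\{0\}$ and $\operatorname{ran}(T-a)$ is dense in but not equal to $\mathcal H$. $T$ is dissipative (accumulative) if $\operatorname{Im}(h',h)\ge0$ ($\le0$) for all $\{h,h'\}\in T$, and maximal dissipative (accumulative) if it has no proper dissipative (accumulative) extension. A Nevanlinna family (class $\widetilde R(\mathcal H)$) is a family of linear relations $\mathcal F(z)$, $z\in\mathbb C\setminus\mathbb R$, such that: (NF1) $\mathcal F(z)$ is maximal dissipative for $z\in\mathbb C_+$ and maximal accumulative for $z\in\mathbb C_-$; (NF2) $\mathcal F(z)^*=\mathcal F(\bar z)$; (NF3) for some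 (and hence for all) $w\in\mathbb C_+$ ($w\in\mathbb C_-$) the $\mathcal B(\mathcal H)$-valued function $(\mathcal F(z)+w)^{-1}$ is holomorphic in $z\in\mathbb C_+$ ($z\in\mathbb C_-$). A Nevanlinna pair is a pair $\{\Phi,\Psi\}$ of $\mathcal B(\mathcal H)$-valued functions holomorphic on $\mathbb C\setminus\mathbb R$ such that: (NP1) $\operatorname{Im}(\Phi(z)^*\Psi(z))/\operatorname{Im}z\ge0$ for $z\in\mathbb C\setminus\mathbb R$; (NP2) $\Psi(\bar z)^*\Phi(z)-\Phi(\bar z)^*\Psi(z)=0$ for $z\in\mathbb C\setminus\mathbb R$; (NP3) $0\in\rho(\Psi(z)\pm i\Phi(z))$ for $z\in\mathbb C_\pm$. The corresponding Nevanlinna family is $\mathcal F(z)=\{\{\Phi(z)h,\Psi(z)h\}:h\in\mathcal H\}$. Further, $$\mathsf N_{\Phi,\Psi}(z,w)=\frac{\Phi(w)^*\Psi(z)-\Psi(w)^*\Phi(z)}{z-\bar w}.$$ *)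

(* Defs.v *)
From HB Require Import structures.
From mathcomp Require Import all_boot all_order all_algebra.
From mathcomp Require Import all_classical all_reals all_analysis.
From mathcomp Require Import complex.

Set Implicit Arguments.
Unset Strict Implicit.
Unset Printing Implicit Defensive.

Import Order.TTheory GRing.Theory Num.Theory.
Import numFieldNormedType.Exports.

Local Open Scope classical_set_scope.
Local Open Scope ring_scope.

(* A complex Hilbert space is a [completeNormedModType R[i]] with an inner
   product [dot : {dot H for Num.conj}] (linear in the first argument,
   conjugate-linear in the second) that induces the norm. *)

Definition norm_from_dot (R : realType) (H : completeNormedModType R[i])
  (dot : {dot H for Num.conj}) : Prop := forall x : H, dot x x = `|x| ^+ 2.

Definition separable (T : topologicalType) : Prop :=
  exists2 S : set T, countable S & dense S.

Section HalfPlanes.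
Context {R : realType}.

Definition upper_half_plane : set R[i] := [set z | 0 < 'Im z].
Definition lower_half_plane : set R[i] := [set z | 'Im z < 0].
Definition nonreal : set R[i] := [set z | 'Im z != 0].

End HalfPlanes.

Section BoundedOperators.
Context {R : realType} {H : completeNormedModType R[i]}.

(* For [0 <= M] this says that the operator norm of [A] is at most [M]. *)
Definition opnorm_le (A : H -> H) (M : R) : Prop :=
  forall x : H, `|A x| <= M%:C%C * `|x|.

Definition bounded_operator (A : H -> H) : Prop :=
  linear A /\ exists M : R, opnorm_le A M.

(* Complex differentiability in the operator norm on the open set [Omega];
   the values of [G] off [Omega] are irrelevant. *)
Definition holomorphic_on (Omega : set R[i]) (G : R[i] -> H -> H) : Prop :=
  (forall z, Omega z -> bounded_operator (G z)) /\
  (forall z, Omega z -> exists2 D : H -> H, bounded_operator D &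
     forall e : R, 0 < e -> \forall w \near (z : R[i]^o)^',
       opnorm_le (fun h => (w - z)^-1 *: (G w h - G z h) - D h) e).

End BoundedOperators.

Section LinearRelations.
Context {R : realType} {H : completeNormedModType R[i]}.
Implicit Types (T S : set (H * H)) (a : R[i]).

Definition linear_relation T : Prop :=
  T 0 /\ forall a p q, T p -> T q -> T (a *: p + q).

Definition rel_ran T : set H := [set g | exists f, T (f, g)].
Definition rel_ker T : set H := [set f | T (f, 0)].
Definition rel_mul T : set H := [set g | T (0, g)].

Definition rel_shift T a : set (H * H) :=
  [set p | exists f g, T (f, g) /\ p = (f, g - a *: f)].
Definition rel_inv T : set (H * H) := [set p | T (p.2, p.1)].

Definition graph (A : H -> H) : set (H * H) := [set p | p.2 = A p.1].

Definition in_BH T : Prop := exists2 A, bounded_operator A & T = graph A.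

Definition point_spectrum T : set R[i] :=
  [set a | rel_ker (rel_shift T a) <> [set 0]].
Definition continuous_spectrum T : set R[i] :=
  [set a | [/\ rel_ker (rel_shift T a) = [set 0],
               dense (rel_ran (rel_shift T a)) &
               rel_ran (rel_shift T a) <> setT]].
Definition resolvent_set T : set R[i] :=
  [set a | in_BH (rel_inv (rel_shift T a))].

Variable dot : {dot H for Num.conj}.

Definition rel_adjoint T : set (H * H) :=
  [set p | forall f g, T (f, g) -> dot p.2 f = dot p.1 g].

Definition dissipative T : Prop :=
  forall h h', T (h, h') -> 0 <= 'Im (dot h' h).
Definition accumulative T : Prop :=
  forall h h', T (h, h') -> 'Im (dot h' h) <= 0.

Definition maximal_dissipative T : Prop :=
  dissipative T /\
  forall S, linear_relation S -> dissipative S -> T `<=` S -> S = T.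
Definition maximal_accumulative T : Prop :=
  accumulative T /\
  forall S, linear_relation S -> accumulative S -> T `<=` S -> S = T.

(* The operator whose graph is [rel_adjoint (graph A)]; for a bounded operator
   [A] the selected set is a singleton (Riesz), elsewhere [0] is a default. *)
Definition adjoint (A : H -> H) : H -> H :=
  fun h => xget 0 [set k | rel_adjoint (graph A) (h, k)].

Definition op_Im (A : H -> H) : H -> H :=
  fun h => (2 * 'i)^-1 *: (A h - adjoint A h).

(* The order of [R[i]] makes [0 <= dot (A h) h] include that it is real. *)
Definition op_ge0 (A : H -> H) : Prop := forall h, 0 <= dot (A h) h.

End LinearRelations.

Section Nevanlinna.
Context {R : realType} {H : completeNormedModType R[i]}.
Variable dot : {dot H for Num.conj}.

(* [G] is the B(H)-valued function [z |-> (F z + w)^-1], under the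
   identification of operators with their graphs. *)
Definition holomorphic_resolvent (Omega : set R[i]) (F : R[i] -> set (H * H))
    (w : R[i]) : Prop :=
  exists2 G : R[i] -> H -> H, holomorphic_on Omega G &
    forall z, Omega z -> rel_inv (rel_shift (F z) (- w)) = graph (G z).

Record nevanlinna_family (F : R[i] -> set (H * H)) : Prop := {
  nf_linear : forall z, nonreal z -> linear_relation (F z) ;
  nf_dissipative :
    forall z, upper_half_plane z -> maximal_dissipative dot (F z) ;
  nf_accumulative :
    forall z, lower_half_plane z -> maximal_accumulative dot (F z) ;
  nf_adjoint :
    forall z, nonreal z -> rel_adjoint dot (F z) = F (z^*) ;
  nf_holomorphic_upper : exists2 w, upper_half_plane w &
    holomorphic_resolvent upper_half_plane F w ;
  nf_holomorphic_lower : exists2 w, lower_half_plane w &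
    holomorphic_resolvent lower_half_plane F w
}.

Record nevanlinna_pair (Phi Psi : R[i] -> H -> H) : Prop := {
  np_holomorphic_Phi : holomorphic_on nonreal Phi ;
  np_holomorphic_Psi : holomorphic_on nonreal Psi ;
  np_ge0 : forall z, nonreal z ->
    op_ge0 dot (fun h =>
      ('Im z)^-1 *: op_Im dot (adjoint dot (Phi z) \o Psi z) h) ;
  np_symmetric : forall z, nonreal z -> forall h,
    adjoint dot (Psi (z^*)) (Phi z h)
      - adjoint dot (Phi (z^*)) (Psi z h) = 0 ;
  np_resolvent_upper : forall z, upper_half_plane z ->
    resolvent_set (graph (fun h => Psi z h + 'i *: Phi z h)) 0 ;
  np_resolvent_lower : forall z, lower_half_plane z ->
    resolvent_set (graph (fun h => Psi z h - 'i *: Phi z h)) 0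
}.

Definition pair_family (Phi Psi : R[i] -> H -> H) (z : R[i]) : set (H * H) :=
  [set p | exists h, p = (Phi z h, Psi z h)].

Definition nevanlinna_kernel (Phi Psi : R[i] -> H -> H) (z w : R[i]) : H -> H :=
  fun h => (z - w^*)^-1 *:
    (adjoint dot (Phi w) (Psi z h) - adjoint dot (Psi w) (Phi z h)).

End Nevanlinna.

(* Main.v *)
Require Import Defs.
From HB Require Import structures.
From mathcomp Require Import all_boot all_order all_algebra.
From mathcomp Require Import all_classical all_reals all_analysis.
From mathcomp Require Import complex ring lra.

Set Implicit Arguments.
Unset Strict Implicit.
Unset Printing Implicit Defensive.

Import Order.TTheory GRing.Theory Num.Theory.
Import numFieldNormedType.Exports.

Local Open Scope classical_set_scope.
Local Open Scope ring_scope.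

Import ComplexField.Normc.

(** The only analytic input is a Harnack inequality: for [p], [w] in the upper
    half-plane there is a constant [K] such that [|G w| <= K |G p|] for every
    [G] that is holomorphic there with [Re G >= 0] ([harnack_half_plane]).
    Inner products are written [<x, y>] below, to tell them from pairs.

    Fix [w] with [Im w > 0].  In the upper half-plane, the Cayley transform
    [Th z : g + w f |-> g + w^* f], for [(f, g)] in [F z], is an everywhere
    defined contraction, holomorphic in [z] because [(F z + w)^-1] is, and
    [|g + w f|^2 - |g + w^* f|^2 = 4 Im w Im <g, f>].  For fixed vectors the
    function [|x| |k| - <Th z x, k>] has nonnegative real part, so its sizes at
    two points [p] and [z] are comparable, uniformly in [x] and [k]
    ([harnack_cayley]).  Three choices of [k] give everything.
    - [k = Th p x] when [|k| = |x|]: the quantity vanishes at [p], hence at [z],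
      and the case of equality in the Cauchy-Schwarz inequality makes
      [Th z x = k].  So a pair [(f, g)] with [Im <g, f> = 0] lies in [F z] for
      all [z] or for none ([neutral_everywhere]).  The pairs [(h, a h)], [(0, g)]
      and [(Phi z h, Psi z h)] with [N(z,z) h = 0] are of this kind, whence the
      statements on [ker (F z - a)], on [mul (F z)] and on the kernel of [N].
    - [k] a fixed unimodular multiple of [x]: an estimate
      [|f|, |g| <= M |gam f + del g|] on [F z], with [gam], [del] real, passes
      from one point to another ([comb_bounded_upper]).  This gives the
      statements on [rho (F z)] and on boundedness of [F z].
    - [k = Th z x]: so does the estimate [c (|f|^2 + |g|^2) <= |Im <g, f>|]
      ([definite_upper]), which says that [N(z,z)] is bounded below.

    The two half-planes are linked by [(F z)^* = F z^*].  A neutral vector of a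
    semidefinite form is orthogonal to everything, which handles the first
    case; the other two use duality.  Let [S = T^*] and [T = S^*].  If [T] is
    bounded below and [ker S] is trivial, then [T^-1] is a bounded operator
    ([bounded_below_in_BH]); if [T] is onto, then [S] is bounded below, by
    uniform boundedness ([surjective_bounded_below]).  Together with
    [(ran T)^perp = ker S] these two facts also turn the estimates into
    statements about [rho] and [sigma_c] ([spectrum_transfer]).

    The Harnack inequality follows from a Schwarz lemma, for which a Cauchy
    estimate with a bad constant is good enough.  That estimate comes from
    Goursat's lemma, as the derivative is not assumed to be continuous.  Contour
    integrals are replaced by dyadic midpoint sums: they are exactly additive
    under subdivision and exact on affine functions, which is all that
    Goursat's argument needs. *)

(** * Complex numbers and complex differentiability *)

Section Scalars.
Context {R : realType}.
Local Notation C := R[i].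
Implicit Types (z w d c u v : C) (f g : C -> C).

Lemma normr_normc z : `|z| = (normc z)%:C%C.
Proof. by []. Qed.

Lemma normc_ge0 z : 0 <= normc z.
Proof. by rewrite -lecR -normr_normc normr_ge0. Qed.

Lemma normc_real (t : R) : normc t%:C%C = `|t|.
Proof. by rewrite /= expr0n addr0 sqrtr_sqr. Qed.

Lemma normc_eq0 z : (normc z == 0) = (z == 0).
Proof.
apply/eqP/eqP => [|->]; [exact: eq0_normc|exact: normc0].
Qed.

Lemma normc_gt0 z : (0 < normc z) = (z != 0).
Proof. by rewrite lt_def normc_ge0 andbT normc_eq0. Qed.

Lemma normc_sqr z : normc z ^+ 2 = complex.Re z ^+ 2 + complex.Im z ^+ 2.
Proof. by case: z => a b /=; rewrite sqr_sqrtr // addr_ge0 ?sqr_ge0. Qed.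

Lemma normc2 : normc (2 : C) = 2.
Proof. by rewrite -(rmorph_nat (real_complex R) 2) normc_real ger0_norm. Qed.

Lemma normc_i : normc ('i%C : C) = 1.
Proof. by rewrite /= expr0n add0r expr1n sqrtr1. Qed.

Lemma real_complex_half (t : R) : (t / 2)%:C%C = t%:C%C / 2 :> C.
Proof. by rewrite rmorphM /= fmorphV rmorph_nat. Qed.

Lemma Im_le_normc z : `|complex.Im z| <= normc z.
Proof.
rewrite -(@ler_pXn2r _ 2) ?nnegrE ?normc_ge0 ?normr_ge0 //.
by rewrite normc_sqr real_normK ?num_real // lerDr sqr_ge0.
Qed.

Lemma Re_le_normc z : `|complex.Re z| <= normc z.
Proof.
rewrite -(@ler_pXn2r _ 2) ?nnegrE ?normc_ge0 ?normr_ge0 //.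
by rewrite normc_sqr real_normK ?num_real // lerDl sqr_ge0.
Qed.

Lemma normcB z w : normc (z - w) = normc (w - z).
Proof. by rewrite -normcN opprB. Qed.

Lemma le_normcB z w : normc (z - w) <= normc z + normc w.
Proof. by rewrite -(normcN w); exact: le_normcD. Qed.

Lemma derivable_eps f z : derivable (f : C^o -> C^o) z 1 ->
  exists d, forall e : R, 0 < e -> exists2 del : R, 0 < del &
    forall w, normc (w - z) < del ->
      normc (f w - f z - d * (w - z)) <= e * normc (w - z).
Proof.
move=> df; pose d : C := 'D_1 (f : C^o -> C^o) z; exists d => e e0.
pose q (h : C^o) : C^o := h^-1 *: (f (h *: (1 : C^o) + z) - f z).
have /(cvgrPdist_le q (d : C^o)).1 := df : q x @[x --> (0 : C^o)^'] --> (d : C^o).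
move=> /(_ e%:C%C).
rewrite ltcR => /(_ e0).
rewrite near_withinE => /nbhs_normP[[del di]] /=.
rewrite ltcE /= => /andP[/eqP ->] del0 H.
exists del => // w wz.
have [->|wz0] := eqVneq w z; first by rewrite !subrr mulr0 subr0 normc0 mulr0.
have wz1 : w - z != 0 by rewrite subr_eq0.
have := H (w - z).
rewrite /= sub0r normrN normr_normc ltcR => /(_ wz wz1).
rewrite /q {1}/GRing.scale /= /GRing.scale /= mulr1 subrK => {}H.
have : normc (w - z) * normc (d - (w - z)^-1 * (f w - f z))
   <= e * normc (w - z).
  by rewrite mulrC ler_wpM2r ?normc_ge0 // -lecR.
rewrite -normcM -normcN; congr (normc _ <= _).
by rewrite mulrBr mulrA divff // mul1r; move: d {H} => d; ring.
Qed.

Lemma eps_derivable f z d : (forall e : R, 0 < e -> exists2 del : R, 0 < del &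
    forall w, normc (w - z) < del ->
      normc (f w - f z - d * (w - z)) <= e * normc (w - z)) ->
  derivable (f : C^o -> C^o) z 1.
Proof.
move=> H; apply/cvg_ex; exists (d : C^o).
apply/(cvgrPdist_le (fun h : C^o => h^-1 *: (f (h *: (1 : C^o) + z) - f z) : C^o) (d : C^o)) => -[e ei].
rewrite ltcE /= => /andP[/eqP ->] e0 {ei}.
have [del del0 {}H] := H e e0.
rewrite near_withinE; apply/nbhs_normP; exists del%:C%C; first by rewrite /= ltcR.
move=> h /=; rewrite sub0r normrN normr_normc ltcR => hdel h0.
rewrite {1}/GRing.scale /= /GRing.scale /= mulr1 normr_normc lecR.
have := H (h + z); rewrite addrK => /(_ hdel).
have hn : 0 < normc h by rewrite normc_gt0.
rewrite [e * _]mulrC => {}H; rewrite -(ler_pM2l hn) -normcM.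
have -> : h * (d - h^-1 * (f (h + z) - f z)) = - (f (h + z) - f z - d * h).
  by rewrite mulrBr mulrA divff // mul1r; ring.
by rewrite normcN.
Qed.

Local Notation holo f z := (derivable ((f : C -> C) : C^o -> C^o) z 1).

Lemma holo_cst a z : holo (fun=> a) z.
Proof. exact: (@derivable_cst _ C^o C^o a). Qed.

Lemma holo_id z : holo id z.
Proof. exact: (@derivable_id _ C^o). Qed.

Lemma holoD f g z : holo f z -> holo g z -> holo (fun x => f x + g x) z.
Proof. exact: (@derivableD _ C^o C^o f g). Qed.

Lemma holoB f g z : holo f z -> holo g z -> holo (fun x => f x - g x) z.
Proof. exact: (@derivableB _ C^o C^o f g). Qed.

Lemma holoM f g z : holo f z -> holo g z -> holo (fun x => f x * g x) z.
Proof. exact: (@derivableM _ C^o f g). Qed.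

Lemma holoV f z : f z != 0 -> holo f z -> holo (fun x => (f x)^-1) z.
Proof. exact: (@derivableV _ C^o f). Qed.

Lemma exists_exp2V_lt (e : R) : 0 < e -> exists k, 2 ^- k < e.
Proof.
move=> e0; exists (Num.truncn e^-1).+1.
rewrite -[ltRHS]invrK ltf_pV2 ?posrE ?exprn_gt0 ?invr_gt0 //.
apply: (lt_trans (truncnS_gt _)); rewrite -natrX ltr_nat; exact: ltn_expl.
Qed.

End Scalars.

(** * Discrete contour sums *)

Section Contours.
Context {R : realType}.
Local Notation C := R[i].
Implicit Types (z w d c u v : C) (f g : C -> C) (n : nat).

(** The composite midpoint rule with [2 ^ n] nodes for the integral of [f dz] over
    the segment from [z] to [z + d].  The recursion halves the segment, so that
    additivity under subdivision holds by definition. *)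
Fixpoint chord_sum n f z d : C :=
  if n is n'.+1 then chord_sum n' f z (d / 2) + chord_sum n' f (z + d / 2) (d / 2)
  else f (z + d / 2) * d.

Definition loop_sum n f c u v : C :=
  chord_sum n f c u + chord_sum n f (c + u) v
  - chord_sum n f (c + v) u - chord_sum n f c v.

Lemma half_half d : d / 2 + d / 2 = d :> C.
Proof. by field. Qed.

Lemma chord_sumB n f g z d :
  chord_sum n (fun x => f x - g x) z d = chord_sum n f z d - chord_sum n g z d.
Proof.
elim: n z d => [|n IH] z d /=; first by rewrite mulrBl.
by rewrite !IH; ring.
Qed.

Lemma chord_sumZ n f a z d :
  chord_sum n (fun x => a * f x) z d = a * chord_sum n f z d.
Proof.
elim: n z d => [|n IH] z d /=; first by rewrite mulrA.
by rewrite !IH mulrDr.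
Qed.

(** Under translation of the chord the sum changes exactly as the integral does:
    this is why loop sums of affine functions vanish. *)
Lemma chord_sum_affine n a b z w d :
  chord_sum n (fun x => a + b * x) (z + w) d =
  chord_sum n (fun x => a + b * x) z d + b * w * d.
Proof.
elim: n z d => [|n IH] z d /=; first by ring.
by rewrite -[in X in _ + X]addrA [w + _]addrC addrA !IH; field.
Qed.

Lemma half_itv (t : R) : 0 <= t <= 1 -> (0 <= t / 2 <= 1) && (0 <= 1 / 2 + t / 2 <= 1).
Proof. lra. Qed.

Lemma chord_point1 z d (t : R) : z + t%:C%C * (d / 2) = z + (t / 2)%:C%C * d.
Proof. by rewrite rmorphM /= fmorphV rmorph_nat; ring. Qed.

Lemma chord_point2 z d (t : R) :
  z + d / 2 + t%:C%C * (d / 2) = z + (1 / 2 + t / 2)%:C%C * d.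
Proof.
by rewrite rmorphD !rmorphM /= fmorphV rmorph_nat; ring.
Qed.

Lemma chord_midpoint z d : z + (1 / 2 : R)%:C%C * d = z + d / 2.
Proof. by rewrite mul1r fmorphV rmorph_nat mulrC. Qed.

Lemma chord_sum_le n f z d (M : R) :
  (forall t : R, 0 <= t <= 1 -> normc (f (z + t%:C%C * d)) <= M) ->
  normc (chord_sum n f z d) <= M * normc d.
Proof.
elim: n z d => [|n IH] z d H /=.
  rewrite normcM ler_wpM2r ?normc_ge0 //.
  by have := H (1 / 2); rewrite chord_midpoint; apply; lra.
have nd : normc d = normc (d / 2) + normc (d / 2).
  by rewrite -{1}(half_half d) -mulr2n normcMn mulr2n.
apply: (le_trans (le_normcD _ _)); rewrite nd mulrDr; apply: lerD; apply: IH => t /half_itv /andP[t1 t2].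
  by rewrite chord_point1; apply: H.
by rewrite chord_point2; apply: H.
Qed.

(** The half-plane [m <= Im] is convex, so a bound on the integrand survives
    averaging. *)
Lemma chord_sum_Im n f z d (m : R) :
  (forall t : R, 0 <= t <= 1 -> m <= complex.Im (f (z + t%:C%C * d) * d)) ->
  m <= complex.Im (chord_sum n f z d).
Proof.
elim: n z d m => [|n IH] z d m H /=.
  by have := H (1 / 2); rewrite chord_midpoint; apply; lra.
have Imh x : complex.Im (x * (d / 2)) = complex.Im (x * d) / 2.
  by rewrite -(rmorph_nat (real_complex R) 2) -fmorphV mulrA; case: (x * d) => ? ? /=; ring.
rewrite (_ : complex.Im _ = complex.Im (chord_sum n f z (d / 2))
   + complex.Im (chord_sum n f (z + d / 2) (d / 2))); last first.
  by case: (chord_sum _ _ _ _) => ? ?; case: (chord_sum _ _ _ _).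
rewrite (_ : m = m / 2 + m / 2); last by field.
by apply: lerD; apply: IH => t /half_itv /andP[t1 t2];
  rewrite Imh ler_pM2r ?invr_gt0 // ?chord_point2 ?chord_point1; apply: H.
Qed.

(** The interior edges cancel exactly, with no limit involved, because the four
    small loops sample them at the same nodes. *)
Lemma loop_sum_split n f c u v :
  loop_sum n.+1 f c u v =
    loop_sum n f c (u / 2) (v / 2) + loop_sum n f (c + u / 2) (u / 2) (v / 2)
  + loop_sum n f (c + v / 2) (u / 2) (v / 2)
  + loop_sum n f (c + u / 2 + v / 2) (u / 2) (v / 2).
Proof.
rewrite /loop_sum /=.
have -> : c + u / 2 + u / 2 = c + u by rewrite -addrA half_half.
have -> : c + v / 2 + v / 2 = c + v by rewrite -addrA half_half.
have -> : c + u / 2 + v / 2 + u / 2 = c + u + v / 2.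
  by rewrite (addrAC (c + u / 2)) -(addrA c) half_half.
have -> : c + u / 2 + v / 2 + v / 2 = c + v + u / 2.
  by rewrite -(addrA (c + u / 2)) half_half addrAC.
have -> : c + v / 2 + u / 2 = c + u / 2 + v / 2 by rewrite addrAC.
ring.
Qed.

Lemma loop_sum_le n f c u v (M : R) :
  (forall s t : R, 0 <= s <= 1 -> 0 <= t <= 1 ->
     normc (f (c + s%:C%C * u + t%:C%C * v)) <= M) ->
  normc (loop_sum n f c u v) <= 2 * M * (normc u + normc v).
Proof.
move=> H.
have b0 : 0 <= (0 : R) <= 1 by lra.
have b1 : 0 <= (1 : R) <= 1 by lra.
have h1 : normc (chord_sum n f c u) <= M * normc u.
  by apply: chord_sum_le => t tb; have := H t 0 tb b0; rewrite mul0r addr0.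
have h2 : normc (chord_sum n f (c + u) v) <= M * normc v.
  by apply: chord_sum_le => t tb; have := H 1 t b1 tb; rewrite mul1r.
have h3 : normc (chord_sum n f (c + v) u) <= M * normc u.
  apply: chord_sum_le => t tb; have := H t 1 tb b1; rewrite mul1r.
  by rewrite addrAC.
have h4 : normc (chord_sum n f c v) <= M * normc v.
  by apply: chord_sum_le => t tb; have := H 0 t b0 tb; rewrite mul0r addr0.
have := le_normcB (chord_sum n f c u + chord_sum n f (c + u) v
  - chord_sum n f (c + v) u) (chord_sum n f c v).
have := le_normcB (chord_sum n f c u + chord_sum n f (c + u) v) (chord_sum n f (c + v) u).
have := le_normcD (chord_sum n f c u) (chord_sum n f (c + u) v).
rewrite -/(loop_sum n f c u v); lra.
Qed.

(** Goursat's argument subtracts the first-order expansion at the limit point;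
    the loop sum does not notice. *)
Lemma loop_sum_affine n f c u v a b :
  loop_sum n (fun x => f x - (a + b * x)) c u v = loop_sum n f c u v.
Proof.
rewrite /loop_sum !chord_sumB !(chord_sum_affine n a b c); ring.
Qed.

End Contours.

(** * Goursat's lemma *)

Section Bisection.
Context {R : realType}.
Implicit Types (P : R -> R -> R -> Prop) (x y h : R).

(** A square where [P] fails has a quarter where [P] fails; the nested squares so
    obtained shrink to a point, where the local hypothesis is contradicted. *)
Lemma square_bisection P :
  (forall x y h, 0 < h -> P x y (h / 2) -> P (x + h / 2) y (h / 2) ->
     P x (y + h / 2) (h / 2) -> P (x + h / 2) (y + h / 2) (h / 2) -> P x y h) ->
  (forall x y, 0 <= x <= 1 -> 0 <= y <= 1 -> exists2 del, 0 < del &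
     forall x' y' h, 0 < h < del -> x' <= x <= x' + h -> y' <= y <= y' + h ->
       0 <= x' -> x' + h <= 1 -> 0 <= y' -> y' + h <= 1 -> P x' y' h) ->
  P 0 0 1.
Proof.
move=> Psplit Ploc; apply: contrapT => nP.
have step x y h : exists q : R * R, 0 < h -> ~ P x y h ->
    [/\ ~ P q.1 q.2 (h / 2), q.1 = x \/ q.1 = x + h / 2 & q.2 = y \/ q.2 = y + h / 2].
  case: (pselect (P x y (h / 2))) => h1; last by exists (x, y) => _ _; split => //=; left.
  case: (pselect (P (x + h / 2) y (h / 2))) => h2.
    2: by exists (x + h / 2, y) => _ _; split => //=; [right|left].
  case: (pselect (P x (y + h / 2) (h / 2))) => h3.
    2: by exists (x, y + h / 2) => _ _; split => //=; [left|right].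
  case: (pselect (P (x + h / 2) (y + h / 2) (h / 2))) => h4.
    by exists (x, y) => h0 []; exact: Psplit.
  by exists (x + h / 2, y + h / 2) => _ _; split => //=; right.
have [|next nextP] := @choice (R * R * R)%type (R * R)%type (fun q r => 0 < q.2 ->
    ~ P q.1.1 q.1.2 q.2 ->
    [/\ ~ P r.1 r.2 (q.2 / 2), r.1 = q.1.1 \/ r.1 = q.1.1 + q.2 / 2 &
        r.2 = q.1.2 \/ r.2 = q.1.2 + q.2 / 2]).
  by move=> -[[x y] h]; exact: step.
pose h k : R := 2 ^- k.
have h0 k : 0 < h k by rewrite invr_gt0 exprn_gt0.
have hS k : h k.+1 = h k / 2 by rewrite /h exprS invfM mulrC.
pose c := fix c k := if k is k'.+1 then next (c k', h k') else (0, 0).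
have cP k : ~ P (c k).1 (c k).2 (h k).
  elim: k => [|k IH]; first by rewrite /h expr0 invr1.
  by have [+ _ _] := nextP (c k, h k) (h0 k) IH; rewrite -hS.
have cS1 k : (c k).1 <= (c k.+1).1 /\ (c k.+1).1 + h k.+1 <= (c k).1 + h k.
  have [_ H _] := nextP (c k, h k) (h0 k) (cP k).
  by have := h0 k; rewrite hS /=; case: H => ->; split; rewrite /=; lra.
have cS2 k : (c k).2 <= (c k.+1).2 /\ (c k.+1).2 + h k.+1 <= (c k).2 + h k.
  have [_ _ H] := nextP (c k, h k) (h0 k) (cP k).
  by have := h0 k; rewrite hS /=; case: H => ->; split; rewrite /=; lra.
have nested (a : nat -> R) : a 0%N = 0 ->
    (forall k, a k <= a k.+1 /\ a k.+1 + h k.+1 <= a k + h k) ->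
    (forall k, 0 <= a k /\ a k + h k <= 1) /\ exists p, forall k, a k <= p <= a k + h k.
  move=> a0 aS.
  have up k m : a k <= a (k + m)%N /\ a (k + m)%N + h (k + m)%N <= a k + h k.
    elim: m => [|m [IH1 IH2]]; first by rewrite addn0.
    by have [] := aS (k + m)%N; rewrite addnS; split; lra.
  split=> [k|].
    by have := up 0%N k; rewrite add0n a0 /h expr0 invr1 add0r => -[].
  have ub k m : a m <= a k + h k.
    case: (leqP k m) => km.
      by have [_] := up k (m - k)%N; rewrite subnKC //; have := h0 m; lra.
    by have [+ _] := up m (k - m)%N; rewrite subnKC ?(ltnW km) //; have := h0 k; lra.
  exists (sup (range a)) => k; apply/andP; split.
    apply: ub_le_sup; last by exists k.
    by exists (a 0%N + h 0%N) => _ [m _ <-].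
  by apply: ge_sup; [exists (a 0%N), 0%N|move=> _ [m _ <-]].
have [b1 [x xP]] := nested (fun k => (c k).1) erefl cS1.
have [b2 [y yP]] := nested (fun k => (c k).2) erefl cS2.
have hh0 : h 0%N = 1 by rewrite /h expr0 invr1.
have := Ploc x y; have := xP 0%N; have := yP 0%N; rewrite hh0 /= !add0r => -> -> /(_ isT isT)[del del0].
have [k kdel] := exists_exp2V_lt del0.
move=> /(_ (c k).1 (c k).2 (h k)) H; apply: (cP k); apply: H; rewrite ?h0 ?kdel //.
- by case: (b1 k).
- by case: (b1 k).
- by case: (b2 k).
- by case: (b2 k).
Qed.
End Bisection.

Section Goursat.
Context {R : realType}.
Local Notation C := R[i].
Implicit Types (z w d c u v : C) (f g F G : C -> C) (n k : nat).
Local Notation holo f z := (derivable ((f : C -> C) : C^o -> C^o) z 1).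

(** The property propagated by bisection is [|loop_sum n| <= e * h ^+ 2] for all
    large [n], on the parallelogram scaled by [h]: the bounds add up to that of
    the whole, and near each point it follows from differentiability. *)
Lemma goursat f c u v :
  (forall s t : R, 0 <= s <= 1 -> 0 <= t <= 1 -> holo f (c + s%:C%C * u + t%:C%C * v)) ->
  forall e : R, 0 < e -> exists n0, forall n, (n0 <= n)%N -> normc (loop_sum n f c u v) <= e.
Proof.
move=> df e e0.
pose L := normc u + normc v.
have L0 : 0 <= L by rewrite addr_ge0 ?normc_ge0.
pose P (x y h : R) := exists n0, forall n, (n0 <= n)%N ->
  normc (loop_sum n f (c + x%:C%C * u + y%:C%C * v) (h%:C%C * u) (h%:C%C * v)) <= e * h ^+ 2.
suff : P 0 0 1.
  by move=> [n0 H]; exists n0 => n /H; rewrite !mul0r !addr0 !mul1r expr1n mulr1.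
apply: square_bisection => [x y h h0 [n1 H1] [n2 H2] [n3 H3] [n4 H4]|x y xb yb].
  exists (maxn (maxn n1 n2) (maxn n3 n4)).+1 => -[//|n].
  rewrite ltnS !geq_max => /andP[/andP[/H1 {}H1 /H2 {}H2] /andP[/H3 {}H3 /H4 {}H4]].
  rewrite loop_sum_split.
  have E w : h%:C%C * w / 2 = (h / 2)%:C%C * w by rewrite real_complex_half; ring.
  rewrite !E; set c0 := c + x%:C%C * u + y%:C%C * v.
  have e2 : c0 + (h / 2)%:C%C * u = c + (x + h / 2)%:C%C * u + y%:C%C * v.
    by rewrite /c0 rmorphD /=; ring.
  have e3 : c0 + (h / 2)%:C%C * v = c + x%:C%C * u + (y + h / 2)%:C%C * v.
    by rewrite /c0 rmorphD /=; ring.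
  rewrite e3 e2.
  have -> : c + (x + h / 2)%:C%C * u + y%:C%C * v + (h / 2)%:C%C * v
     = c + (x + h / 2)%:C%C * u + (y + h / 2)%:C%C * v.
    by rewrite (rmorphD _ y) /=; ring.
  have -> : e * h ^+ 2 = e * (h / 2) ^+ 2 + e * (h / 2) ^+ 2 + e * (h / 2) ^+ 2
     + e * (h / 2) ^+ 2 by field.
  by do 3 (apply: (le_trans (le_normcD _ _)); apply: lerD => //).
set p := c + x%:C%C * u + y%:C%C * v.
have [d dP] := derivable_eps (df x y xb yb).
pose e1 := e / (2 * L ^+ 2 + 1).
have den0 : 0 < 2 * L ^+ 2 + 1 by rewrite ltr_wpDl // mulr_ge0 // sqr_ge0.
have e10 : 0 < e1 by rewrite divr_gt0.
have [del del0 H] := dP _ e10.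
have L10 : 0 < L + 1 by lra.
exists (del / (L + 1)); first by rewrite divr_gt0.
move=> x' y' h /andP[h0]; rewrite ltr_pdivlMr // => hdel xx yy _ _ _ _.
exists 0%N => n _.
rewrite -(loop_sum_affine n f _ _ _ (f p - d * p) d).
apply: (@le_trans _ _ (2 * (e1 * (h * L)) * (normc (h%:C%C * u) + normc (h%:C%C * v)))); last first.
  rewrite !normcM !normc_real (gtr0_norm h0) -mulrDr -/L.
  have -> : 2 * (e1 * (h * L)) * (h * L) = (2 * L ^+ 2 * e1) * h ^+ 2 by ring.
  rewrite ler_wpM2r ?sqr_ge0 //.
  rewrite -[leRHS](divfK (lt0r_neq0 den0)) -/e1 [leRHS]mulrC ler_pM2r //; lra.
apply: loop_sum_le => s t /andP[s0 s1] /andP[t0 t1].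
set w := _ + _ + _.
have wp : w - p = (x' + s * h - x)%:C%C * u + (y' + t * h - y)%:C%C * v.
  by rewrite /w /p !(rmorphD, rmorphM, rmorphN) /=; ring.
have sh : 0 <= s * h <= h by rewrite mulr_ge0 ?(ltW h0) // ler_piMl // ltW.
have th : 0 <= t * h <= h by rewrite mulr_ge0 ?(ltW h0) // ler_piMl // ltW.
have wpL : normc (w - p) <= h * L.
  rewrite wp; apply: (le_trans (le_normcD _ _)); rewrite /L mulrDr !normcM !normc_real.
  by apply: lerD; apply: ler_wpM2r; rewrite ?normc_ge0 // ler_norml; lra.
have -> : f w - (f p - d * p + d * w) = f w - f p - d * (w - p) by ring.
apply: le_trans (H w _) _; last by rewrite ler_pM2l.
by apply: le_lt_trans wpL _; apply: le_lt_trans hdel; rewrite ler_pM2l //; lra.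
Qed.

End Goursat.

(** * A crude Cauchy estimate *)

Section Cauchy.
Context {R : realType}.
Local Notation C := R[i].
Implicit Types (z w d c u v : C) (f g F G : C -> C) (n k : nat).
Local Notation holo f z := (derivable ((f : C -> C) : C^o -> C^o) z 1).

(** At the corner [c] the function need only be bounded.  Three of the four
    quarters are handled by [goursat], so the limit superior over the whole
    parallelogram is at most that over the corner quarter, hence over
    arbitrarily small ones, where it is at most a multiple of the perimeter. *)
Lemma goursat_corner f c u v (del B : R) : 0 < del ->
  (forall x, normc (x - c) < del -> normc (f x) <= B) ->
  (forall s t : R, 0 <= s <= 1 -> 0 <= t <= 1 -> (s != 0) || (t != 0) ->
     holo f (c + s%:C%C * u + t%:C%C * v)) ->
  forall e : R, 0 < e -> exists n0, forall n, (n0 <= n)%N -> normc (loop_sum n f c u v) <= e.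
Proof.
move=> del0 fB df e e0.
have shrink k u' v' (e' : R) : 0 < e' ->
    (forall s t : R, 0 <= s <= 1 -> 0 <= t <= 1 -> (s != 0) || (t != 0) ->
       holo f (c + s%:C%C * u' + t%:C%C * v')) ->
    exists n0, forall n, (n0 <= n)%N ->
      normc (loop_sum (n + k) f c u' v') <=
      normc (loop_sum n f c ((2 ^- k)%:C%C * u') ((2 ^- k)%:C%C * v')) + e'.
  elim: k u' v' e' => [|k IH] u' v' e' e'0 df'.
    by exists 0%N => n _; rewrite addn0 expr0 invr1 !mul1r lerDl ltW.
  have h2 : (2 : C) != 0 by rewrite pnatr_eq0.
  have e40 : 0 < e' / 4 by rewrite divr_gt0.
  have [] := IH (u' / 2) (v' / 2) _ e40.
    move=> s t sb tb st.
    have -> : c + s%:C%C * (u' / 2) + t%:C%C * (v' / 2) =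
        c + (s / 2)%:C%C * u' + (t / 2)%:C%C * v' by rewrite !real_complex_half; field.
    apply: df'; [lra|lra|].
    by move: st; rewrite !mulf_eq0 !invr_eq0 !pnatr_eq0 !orbF.
  move=> n1 H1.
  have [] := @goursat _ f (c + u' / 2) (u' / 2) (v' / 2) _ _ e40.
    move=> s t sb tb.
    have -> : c + u' / 2 + s%:C%C * (u' / 2) + t%:C%C * (v' / 2) =
        c + ((1 + s) / 2)%:C%C * u' + (t / 2)%:C%C * v' by rewrite !real_complex_half rmorphD rmorph1; field.
    by apply: df'; [lra|lra|apply/orP; left; apply: lt0r_neq0; lra].
  move=> n2 H2.
  have [] := @goursat _ f (c + v' / 2) (u' / 2) (v' / 2) _ _ e40.
    move=> s t sb tb.
    have -> : c + v' / 2 + s%:C%C * (u' / 2) + t%:C%C * (v' / 2) =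
        c + (s / 2)%:C%C * u' + ((1 + t) / 2)%:C%C * v' by rewrite !real_complex_half rmorphD rmorph1; field.
    by apply: df'; [lra|lra|apply/orP; right; apply: lt0r_neq0; lra].
  move=> n3 H3.
  have [] := @goursat _ f (c + u' / 2 + v' / 2) (u' / 2) (v' / 2) _ _ e40.
    move=> s t sb tb.
    have -> : c + u' / 2 + v' / 2 + s%:C%C * (u' / 2) + t%:C%C * (v' / 2) =
        c + ((1 + s) / 2)%:C%C * u' + ((1 + t) / 2)%:C%C * v'.
      by rewrite !real_complex_half !rmorphD rmorph1; field.
    by apply: df'; [lra|lra|apply/orP; right; apply: lt0r_neq0; lra].
  move=> n4 H4.
  exists (maxn (maxn n1 n2) (maxn n3 n4)) => n.
  rewrite !geq_max => /andP[/andP[N1 N2] /andP[N3 N4]].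
  have {}H1 := H1 n N1.
  have {}H2 := H2 _ (leq_trans N2 (leq_addr k n)).
  have {}H3 := H3 _ (leq_trans N3 (leq_addr k n)).
  have {}H4 := H4 _ (leq_trans N4 (leq_addr k n)).
  have E x : (2 ^- k.+1)%:C%C * x = (2 ^- k)%:C%C * (x / 2) :> C.
    have -> : 2 ^- k.+1 = 2 ^- k / 2 :> R by rewrite exprS invfM mulrC.
    by rewrite real_complex_half; ring.
  rewrite addnS loop_sum_split !E.
  set a1 := loop_sum _ _ _ _ _ in H1 *; set a2 := loop_sum _ _ _ _ _ in H2 *.
  set a3 := loop_sum _ _ _ _ _ in H3 *; set a4 := loop_sum _ _ _ _ _ in H4 *.
  have := le_normcD (a1 + a2 + a3) a4; have := le_normcD (a1 + a2) a3; have := le_normcD a1 a2.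
  move: H1 H2 H3 H4; lra.
have B0 : 0 <= B.
  by apply: le_trans (normc_ge0 _) (fB c _); rewrite subrr normc0.
pose L := normc u + normc v.
have L0 : 0 <= L by rewrite addr_ge0 ?normc_ge0.
(* The first bound keeps the small parallelogram where [f] is bounded, the
   second one makes its loop sums smaller than [e / 2]. *)
pose eta := Num.min (del / (L + 1)) (e / 2 / (2 * B * L + 1)).
have BL0 : 0 < 2 * B * L + 1 by rewrite ltr_wpDl // !mulr_ge0.
have L10 : 0 < L + 1 by rewrite ltr_wpDl.
have e20 : 0 < e / 2 by rewrite divr_gt0.
have eta0 : 0 < eta by rewrite lt_min !divr_gt0.
have [k] := exists_exp2V_lt eta0.
rewrite lt_min ltr_pdivlMr // ltr_pdivlMr // => /andP[k1 k2].
have [n0 H] := shrink k u v _ e20 df.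
exists (n0 + k)%N => n nk.
have [m mn ->] : exists2 m, (n0 <= m)%N & n = (m + k)%N.
  exists (n - k)%N; first by rewrite leq_subRL ?(leq_trans (leq_addl n0 k)) // addnC.
  by rewrite subnK // (leq_trans (leq_addl n0 k)).
apply: (le_trans (H m mn)).
have q0 : 0 < (2 ^- k : R) by rewrite invr_gt0 exprn_gt0.
suff: normc (loop_sum m f c ((2 ^- k)%:C%C * u) ((2 ^- k)%:C%C * v)) <= e / 2.
  by move: (normc _) => x; lra.
apply: (@le_trans _ _ (2 * B * (normc ((2 ^- k)%:C%C * u) + normc ((2 ^- k)%:C%C * v)))).
  apply: loop_sum_le => s t sb tb; apply: fB.
  set q := 2 ^- k in q0 k1 k2 *.
  have -> : c + s%:C%C * (q%:C%C * u) + t%:C%C * (q%:C%C * v) - c =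
    (s * q)%:C%C * u + (t * q)%:C%C * v by rewrite !rmorphM /=; ring.
  have sh : `|s * q| <= q.
    by case/andP: sb => ? ?; rewrite ger0_norm ?mulr_ge0 ?(ltW q0) // ler_piMl // ltW.
  have th : `|t * q| <= q.
    by case/andP: tb => ? ?; rewrite ger0_norm ?mulr_ge0 ?(ltW q0) // ler_piMl // ltW.
  apply: le_lt_trans (le_normcD _ _) _; rewrite !normcM !normc_real.
  apply: (@le_lt_trans _ _ (q * L)).
    by rewrite mulrDr lerD // ler_wpM2r // normc_ge0.
  by apply: lt_trans k1; rewrite ltr_pM2l //; lra.
rewrite !normcM !normc_real (gtr0_norm q0) -mulrDr -/L.
have -> : 2 * B * (2 ^- k * L) = 2 ^- k * (2 * B * L) by ring.
apply/ltW; apply: lt_trans k2; rewrite ltr_pM2l //; lra.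
Qed.

(** The part of the boundary of the square with centre [w] and half-side [|rho|]
    that lies in one quadrant.  The spokes of the four loops with corner [w]
    cancel and only the quarters remain. *)
Definition quarter n f w (rho : C) : C :=
  chord_sum n f (w + rho) ('i%C * rho) - chord_sum n f (w + 'i%C * rho) rho.

Lemma quarter_loop n f w rho :
  loop_sum n f w rho ('i%C * rho) =
  quarter n f w rho + chord_sum n f w rho - chord_sum n f w ('i%C * rho).
Proof. by rewrite /loop_sum /quarter; ring. Qed.

Lemma mulCii : 'i%C * 'i%C = -1 :> C.
Proof. by rewrite -expr2 sqr_i. Qed.

Lemma Cre_im_neq0 (s t : R) : (s != 0) || (t != 0) -> s%:C%C + t%:C%C * 'i%C != 0.
Proof.
by move=> st; rewrite eq_complex /= !mul0r !mulr1 mulr0 subrr !addr0 add0r negb_and.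
Qed.

(** On the two edges the integrand is [i / (1 + i t)] and, traversed backwards,
    [1 / (i + t)]; both contribute [1 / (1 + t ^+ 2) >= 1 / 2]. *)
Lemma quarter_inv_Im n w rho : rho != 0 ->
  1 <= complex.Im (quarter n (fun x => (x - w)^-1) w rho).
Proof.
move=> rho0.
have sq t : 0 <= t <= 1 -> 1 / 2 <= (1 + t ^+ 2)^-1 :> R.
  move=> tb; rewrite div1r lef_pV2 ?posrE //; last by rewrite ltr_wpDr ?sqr_ge0.
  nra.
rewrite (_ : complex.Im _ = complex.Im (chord_sum n (fun x => (x - w)^-1) (w + rho) ('i%C * rho))
    + complex.Im (chord_sum n (fun x => -1 * (x - w)^-1) (w + 'i%C * rho) rho)); last first.
  by rewrite chord_sumZ mulN1r /quarter; do 2 case: (chord_sum _ _ _ _) => ? ?.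
have norm0 t : ((1 + t ^+ 2 : R)%:C)%C != 0.
  rewrite -[0]/(0%:C)%C (inj_eq (@complexI _)); apply: lt0r_neq0.
  by rewrite ltr_wpDr ?sqr_ge0.
have sqC t : ((1 + t ^+ 2 : R)%:C)%C = 1 + t%:C%C ^+ 2 by rewrite rmorphD rmorphXn rmorph1.
have ImZ (a s t : R) : complex.Im (a%:C%C * (s%:C%C + t%:C%C * 'i%C)) = a * t.
  by rewrite /= !mul0r; ring.
suff [H1 H2] : 1 / 2 <= complex.Im (chord_sum n (fun x => (x - w)^-1) (w + rho) ('i%C * rho))
  /\ 1 / 2 <= complex.Im (chord_sum n (fun x => -1 * (x - w)^-1) (w + 'i%C * rho) rho) by lra.
split; apply: chord_sum_Im => t tb.
  have t0 : 1 + t%:C%C * 'i%C != 0.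
    by rewrite -(rmorph1 (real_complex R)) Cre_im_neq0 // oner_eq0.
  have -> : (w + rho + t%:C%C * ('i%C * rho) - w)^-1 * ('i%C * rho)
      = (1 + t ^+ 2)^-1%:C%C * (t%:C%C + 1%:C%C * 'i%C).
    have -> : w + rho + t%:C%C * ('i%C * rho) - w = rho * (1 + t%:C%C * 'i%C) by ring.
    apply: (canLR (mulKf (mulf_neq0 rho0 t0))).
    rewrite fmorphV /= rmorph1 mul1r mulrACA [_ * (_ + 'i%C)](_ : _ = 'i%C * (1 + t ^+ 2)%:C%C).
      by rewrite [RHS]mulrCA divfK.
    by rewrite sqC; move: mulCii; move: ('i%C) => I II; ring: II.
  by rewrite ImZ mulr1; apply: sq.
have t0 : t%:C%C + 'i%C != 0.
  by have := @Cre_im_neq0 t 1; rewrite rmorph1 mul1r; apply; rewrite oner_eq0 orbT.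
have -> : -1 * (w + 'i%C * rho + t%:C%C * rho - w)^-1 * rho
    = (1 + t ^+ 2)^-1%:C%C * ((- t)%:C%C + 1%:C%C * 'i%C).
  have -> : w + 'i%C * rho + t%:C%C * rho - w = rho * (t%:C%C + 'i%C) by ring.
  rewrite mulrAC mulrC; apply: (canLR (mulKf (mulf_neq0 rho0 t0))).
  rewrite fmorphV /= rmorph1 rmorphN mul1r mulrACA [_ * (_ + 'i%C)](_ : _ = - (1 + t ^+ 2)%:C%C).
    by rewrite [RHS]mulrN divfK // mulN1r.
  by rewrite sqC; move: mulCii; move: ('i%C) => I II; ring: II.
by rewrite ImZ mulr1; apply: sq.
Qed.

Lemma quarter_le n f w rho (M : R) : rho != 0 ->
  (forall x, normc rho <= normc (x - w) <= 2 * normc rho -> normc (f x) <= M) ->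
  normc (quarter n (fun x => f x / (x - w)) w rho) <= 2 * M.
Proof.
move=> rho0 fM.
have r0 : 0 < normc rho by rewrite normc_gt0.
have edge x : normc rho <= normc (x - w) <= 2 * normc rho ->
    normc (f x / (x - w)) <= M / normc rho.
  move=> xb; have {}fM := fM x xb; case/andP: xb => xb _.
  have M0 : 0 <= M := le_trans (normc_ge0 _) fM.
  rewrite normcM normcV; apply: ler_pM; rewrite ?normc_ge0 ?invr_ge0 ?normc_ge0 //.
  by rewrite lef_pV2 ?posrE // (lt_le_trans r0).
have bounds (s t : R) : (0 <= t <= 1) && (s == 1) || (0 <= s <= 1) && (t == 1) ->
    normc rho <= normc (w + s%:C%C * rho + t%:C%C * ('i%C * rho) - w) <= 2 * normc rho.
  move=> stb.
  have -> : w + s%:C%C * rho + t%:C%C * ('i%C * rho) - w = (s%:C%C + t%:C%C * 'i%C) * rho by ring.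
  rewrite normcM.
  suff /andP[h1 h2] : 1 <= normc (s%:C%C + t%:C%C * 'i%C : C) <= 2.
    by rewrite -{1}[normc rho]mul1r !ler_pM2r // h1.
  have : normc (s%:C%C + t%:C%C * 'i%C : C) ^+ 2 = s ^+ 2 + t ^+ 2.
    by rewrite normc_sqr /=; ring.
  have := normc_ge0 (s%:C%C + t%:C%C * 'i%C : C).
  move: (normc _) => N N0 Ns.
  have sq (a : R) : 0 <= a <= 1 -> 0 <= a ^+ 2 <= 1.
    by case/andP=> a0 a1; rewrite sqr_ge0 expr_le1.
  have {}Ns : 1 <= N ^+ 2 <= 2.
    by case/orP: stb => /andP[/sq ab /eqP st]; move: Ns; rewrite st expr1n; lra.
  rewrite -(@ler_pXn2r _ 2) ?nnegrE // -[X in _ && X](@ler_pXn2r _ 2) ?nnegrE // expr1n.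
  by case/andP: Ns => -> /= /le_trans; apply; lra.
have c1 : normc (chord_sum n (fun x => f x / (x - w)) (w + rho) ('i%C * rho)) <= M.
  have -> : M = M / normc rho * normc ('i%C * rho) by rewrite normcM normc_i mul1r divfK // gt_eqF.
  apply: chord_sum_le => t tb; apply: edge.
  by have := bounds 1 t; rewrite eqxx tb rmorph1 mul1r; apply.
have c2 : normc (chord_sum n (fun x => f x / (x - w)) (w + 'i%C * rho) rho) <= M.
  have -> : M = M / normc rho * normc rho by rewrite divfK // gt_eqF.
  apply: chord_sum_le => t tb; apply: edge.
  have := bounds t 1; rewrite eqxx tb orbT rmorph1 mul1r.
  by rewrite [w + _ + 'i%C * rho]addrAC; apply.
by apply: le_trans (le_normcB _ _) _; lra.
Qed.

(** Cauchy's formula on a square, without its exact constants: the loop sums of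
    [(F x - F w) / (x - w)] tend to 0, while those of [1 / (x - w)] have
    imaginary part at least 4. *)
Lemma cauchy_estimate F w (r M : R) : 0 < r ->
  (forall x, normc (x - w) <= 2 * r -> holo F x) ->
  (forall x, r <= normc (x - w) <= 2 * r -> normc (F x) <= M) ->
  normc (F w) <= 2 * M.
Proof.
move=> r0 dF FM.
pose E x := F x / (x - w) - F w * (x - w)^-1.
have EE x : E x = (F x - F w) / (x - w) by rewrite /E mulrBl.
have EB : exists2 del : R, 0 < del & exists B, forall x, normc (x - w) < del -> normc (E x) <= B.
  have [|d dP] := @derivable_eps _ F w; first by apply: dF; rewrite subrr normc0 mulr_ge0 // ltW.
  have [del del0 H] := dP 1 ltr01.
  exists del => //; exists (1 + normc d) => x /H {}H.
  have [->|xw] := eqVneq x w.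
    by rewrite EE !subrr mul0r normc0 addr_ge0 ?normc_ge0.
  have xw0 : 0 < normc (x - w) by rewrite normc_gt0 subr_eq0.
  rewrite EE normcM normcV ler_pdivrMr //.
  have -> : F x - F w = F x - F w - d * (x - w) + d * (x - w) by ring.
  apply: le_trans (le_normcD _ _) _; rewrite mulrDl; apply: lerD => //.
  by rewrite normcM.
have dE x : x != w -> normc (x - w) <= 2 * r -> holo E x.
  move=> xw xr.
  have dinv : holo (fun x => (x - w)^-1) x.
    apply: (@holoV _ (fun x => x - w)); first by rewrite subr_eq0.
    by apply: holoB; [exact: holo_id|exact: holo_cst].
  apply: holoB; first exact: holoM (dF _ xr) dinv.
  by apply: holoM dinv; exact: holo_cst.
have [del del0 [B EB']] := EB.
have corner rho (e : R) : normc rho = r -> 0 < e -> exists n0, forall n, (n0 <= n)%N ->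
    normc (loop_sum n E w rho ('i%C * rho)) <= e.
  move=> rhor; apply: (goursat_corner del0 EB') => s t sb tb st.
  have D : w + s%:C%C * rho + t%:C%C * ('i%C * rho) - w = (s%:C%C + t%:C%C * 'i%C) * rho by ring.
  apply: dE.
    rewrite -subr_eq0 D mulf_neq0 ?Cre_im_neq0 // -normc_gt0 rhor //.
  rewrite D normcM rhor ler_pM2r //.
  apply: le_trans (le_normcD _ _) _; rewrite normcM normc_i !normc_real !ger0_norm; lra.
apply/ler_addgt0Pr => e e0.
have rr : normc (r%:C%C : C) = r by rewrite normc_real gtr0_norm.
pose rho0 : C := r%:C%C; pose rho1 := 'i%C * rho0; pose rho2 := 'i%C * rho1; pose rho3 := 'i%C * rho2.
have rho4 : 'i%C * rho3 = rho0 by rewrite /rho3 /rho2 /rho1 !mulrA mulCii mulN1r mulNr mulCii opprK mul1r.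
have N1 : normc rho1 = r by rewrite normcM normc_i mul1r.
have N2 : normc rho2 = r by rewrite normcM normc_i mul1r.
have N3 : normc rho3 = r by rewrite normcM normc_i mul1r.
have [n1 H1] := corner rho0 e rr e0.
have [n2 H2] := corner rho1 e N1 e0.
have [n3 H3] := corner rho2 e N2 e0.
have [n4 H4] := corner rho3 e N3 e0.
pose n := maxn (maxn n1 n2) (maxn n3 n4).
have {}H1 : normc (loop_sum n E w rho0 rho1) <= e by apply: H1; rewrite !leq_max leqnn ?orbT.
have {}H2 : normc (loop_sum n E w rho1 rho2) <= e by apply: H2; rewrite !leq_max leqnn ?orbT.
have {}H3 : normc (loop_sum n E w rho2 rho3) <= e by apply: H3; rewrite !leq_max leqnn ?orbT.
have {H4} : normc (loop_sum n E w rho3 ('i%C * rho3)) <= e by apply: H4; rewrite !leq_max leqnn ?orbT.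
rewrite rho4 => H4.
pose Q f := quarter n f w rho0 + quarter n f w rho1 + quarter n f w rho2 + quarter n f w rho3.
have QE : loop_sum n E w rho0 rho1 + loop_sum n E w rho1 rho2 + loop_sum n E w rho2 rho3
    + loop_sum n E w rho3 rho0 = Q (fun x => F x / (x - w)) - F w * Q (fun x => (x - w)^-1).
  transitivity (Q E).
    rewrite -[X in _ + loop_sum n E w rho3 X]rho4 !quarter_loop -/rho1 -/rho2 -/rho3 rho4 /Q; ring.
  by rewrite /Q /quarter /E !chord_sumB !chord_sumZ; ring.
have nz rho : normc rho = r -> rho != 0 by rewrite -normc_gt0 => ->.
have Qle rho : normc rho = r -> normc (quarter n (fun x => F x / (x - w)) w rho) <= 2 * M.
  by move=> rhor; apply: quarter_le; [exact: nz|rewrite rhor; exact: FM].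
have QIm rho : normc rho = r -> 1 <= complex.Im (quarter n (fun x => (x - w)^-1) w rho).
  by move=> /nz; exact: quarter_inv_Im.
have QF : normc (Q (fun x => F x / (x - w))) <= 8 * M.
  have := Qle _ rr; have := Qle _ N1; have := Qle _ N2; have := Qle _ N3; rewrite /Q.
  set a0 := quarter _ _ _ rho0; set a1 := quarter _ _ _ rho1.
  set a2 := quarter _ _ _ rho2; set a3 := quarter _ _ _ rho3.
  have := le_normcD (a0 + a1 + a2) a3; have := le_normcD (a0 + a1) a2; have := le_normcD a0 a1.
  lra.
have Q1 : 4 <= normc (Q (fun x => (x - w)^-1)).
  apply: le_trans (le_trans (ler_norm _) (Im_le_normc _)).
  have := QIm _ rr; have := QIm _ N1; have := QIm _ N2; have := QIm _ N3; rewrite /Q.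
  case: (quarter _ _ _ rho0) => ? ?; case: (quarter _ _ _ rho1) => ? ?.
  case: (quarter _ _ _ rho2) => ? ?; case: (quarter _ _ _ rho3) => ? ? /=; lra.
have : normc (F w * Q (fun x => (x - w)^-1)) <= 8 * M + 4 * e.
  have -> : F w * Q (fun x => (x - w)^-1) = Q (fun x => F x / (x - w)) -
    (loop_sum n E w rho0 rho1 + loop_sum n E w rho1 rho2 + loop_sum n E w rho2 rho3
    + loop_sum n E w rho3 rho0) by rewrite QE; ring.
  apply: le_trans (le_normcB _ _) _.
  move: QF H1 H2 H3 H4; set b := normc (Q _).
  set a0 := loop_sum _ _ _ rho0 _; set a1 := loop_sum _ _ _ rho1 _.
  set a2 := loop_sum _ _ _ rho2 _; set a3 := loop_sum _ _ _ rho3 _.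
  have := le_normcD (a0 + a1 + a2) a3; have := le_normcD (a0 + a1) a2; have := le_normcD a0 a1.
  lra.
rewrite normcM; have := normc_ge0 (F w); move: Q1.
move: (normc (F w)) (normc (Q _)) => x y y4 x0 xy.
have : x * 4 <= x * y by rewrite ler_wpM2l.
lra.
Qed.

End Cauchy.

(** * Schwarz lemma and Harnack inequality *)

Section Harnack.
Context {R : realType}.
Local Notation C := R[i].
Implicit Types (z w d c u v p : C) (f g F G : C -> C) (n k : nat).
Local Notation holo f z := (derivable ((f : C -> C) : C^o -> C^o) z 1).

(** The function is [(x - p) q x ^+ 2] with [q] the difference quotient of [g] at
    [p], which has a limit at [p]. *)
Lemma holo_sqr_div g p : holo g p -> g p = 0 -> holo (fun x => g x * g x / (x - p)) p.
Proof.
move=> dg gp; have [d dP] := derivable_eps dg.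
apply: (@eps_derivable _ _ _ (d * d)) => e e0.
have nd := normc_ge0 d.
pose e' := Num.min 1 (e / (2 * normc d + 1)).
have den0 : 0 < 2 * normc d + 1 by lra.
have e'0 : 0 < e' by rewrite lt_min ltr01 divr_gt0.
have [del del0 H] := dP e' e'0; exists del => // x /H.
rewrite gp !mul0r !subr0.
set h := x - p; set eta := g x - d * h => etah.
have [-> | h0] := eqVneq h 0.
  by rewrite ?(invr0, mulr0, subr0, normc0).
have -> : g x * g x / h - d * d * h = eta * (eta + 2 * d * h) / h by rewrite /eta; field.
have h1 : 0 < normc h by rewrite normc_gt0.
rewrite !normcM normcV ler_pdivrMr //.
have e1 : e' <= 1 by rewrite ge_min lexx.
have e2 : e' * (2 * normc d + 1) <= e by rewrite -ler_pdivlMr // ge_min lexx orbT.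
have eta1 : normc (eta + 2 * d * h) <= (2 * normc d + 1) * normc h.
  apply: le_trans (le_normcD _ _) _; rewrite !normcM normc2.
  have : e' * normc h <= normc h by rewrite ler_piMl // ltW.
  by move: etah; lra.
apply: (@le_trans _ _ ((e' * normc h) * ((2 * normc d + 1) * normc h))).
  by apply: ler_pM; rewrite ?normc_ge0.
have -> : e' * normc h * ((2 * normc d + 1) * normc h) =
  (e' * (2 * normc d + 1)) * (normc h * normc h) by ring.
by rewrite -[leRHS]mulrA ler_wpM2r // mulr_ge0 ?normc_ge0.
Qed.

(** Applying [cauchy_estimate] to [g ^+ 2 / (x - p)] rather than to [g / (x - p)]
    avoids a removable singularity, since the square makes the quotient
    differentiable at [p]; the price is the constant. *)
Lemma schwarz_half g p w (r : R) : 0 < r ->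
  (forall x, normc (x - w) <= 2 * r -> holo g x) ->
  (forall x, normc (x - w) <= 2 * r -> normc (g x) <= 1) ->
  g p = 0 -> normc (w - p) <= r / 16 -> normc (g w) <= 1 / 2.
Proof.
move=> r0 dg g1 gp wp.
have [->|wp0] := eqVneq w p; first by rewrite gp normc0; lra.
have n0 : 0 < normc (w - p) by rewrite normc_gt0 subr_eq0.
have : normc (g w * g w / (w - p)) <= 2 * (2 / r).
  apply: (@cauchy_estimate R (fun x => g x * g x / (x - p)) w r (2 / r) r0) => [x xr|x /andP[xr1 xr2]].
  - have [->|xp] := eqVneq x p.
      by apply: holo_sqr_div gp; apply: dg; rewrite normcB; lra.
    have dgx := dg x xr.
    apply: holoM; first exact: holoM.
    apply: (@holoV _ (fun y => y - p)); first by rewrite subr_eq0.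
    by apply: holoB; [exact: holo_id|exact: holo_cst].
  - have g1x := g1 x xr2.
    have xp : r / 2 <= normc (x - p).
      have := le_normcB (x - p) (w - p).
      have -> : x - p - (w - p) = x - w by ring.
      by move: xr1 wp; lra.
    rewrite !normcM normcV ler_pdivrMr; last by apply: lt_le_trans xp; lra.
    apply: (@le_trans _ _ 1); first by rewrite mulr_ile1 ?normc_ge0.
    rewrite [leLHS](_ : 1 = 2 / r * (r / 2)); last by field; rewrite gt_eqF.
    by rewrite ler_pM2l // divr_gt0.
rewrite !normcM normcV ler_pdivrMr // => H.
have {}H : normc (g w) ^+ 2 <= (1 / 2) ^+ 2.
  rewrite expr2; apply: (le_trans H).
  have -> : (1 / 2) ^+ 2 = 2 * (2 / r) * (r / 16) :> R by field; rewrite gt_eqF.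
  by rewrite ler_pM2l // mulr_gt0 // divr_gt0.
by move: H; rewrite ler_pXn2r ?nnegrE ?normc_ge0 //; lra.
Qed.

(** The Schwarz lemma applies to [(G x - G p) / (G x + (G p)^* )], which maps the
    right half-plane into the unit disc and vanishes at [p]. *)
Lemma harnack_disc_pos G p w (r : R) : 0 < r ->
  (forall x, normc (x - w) <= 2 * r -> holo G x) ->
  (forall x, normc (x - w) <= 2 * r -> 0 < complex.Re (G x)) ->
  normc (w - p) <= r / 16 -> normc (G w) <= 3 * normc (G p).
Proof.
move=> r0 dG G0 wp.
pose g x := (G x - G p) / (G x + conjc (G p)).
have pr : normc (p - w) <= 2 * r by rewrite normcB; lra.
have den x : normc (x - w) <= 2 * r -> G x + conjc (G p) != 0.
  move=> xr; apply/eqP => /(congr1 (@complex.Re R)).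
  have := G0 x xr; have := G0 p pr.
  by case: (G x) => ? ?; case: (G p) => ? ? /=; lra.
have : normc (g w) <= 1 / 2.
  apply: (@schwarz_half g p w r r0) wp => [x xr|x xr|].
  - apply: (@holoM _ (fun x => G x - G p)).
      by apply: holoB; [exact: dG|exact: holo_cst].
    apply: (@holoV _ (fun x => G x + conjc (G p))); first exact: den.
    by apply: holoD; [exact: dG|exact: holo_cst].
  - rewrite /g normcM normcV ler_pdivrMr ?normc_gt0 ?den // mul1r.
    rewrite -(@ler_pXn2r _ 2) ?nnegrE ?normc_ge0 // !normc_sqr.
    have := G0 x xr; have := G0 p pr.
    case: (G x) => a b; case: (G p) => a' b' /= a'0 a0.
    have : 0 < a * a' by rewrite mulr_gt0.
    by lra.
  - by rewrite /g subrr mul0r.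
have wr : normc (w - w) <= 2 * r by rewrite subrr normc0; lra.
rewrite /g normcM normcV ler_pdivrMr ?normc_gt0 ?den // => H.
have nJ : normc (conjc (G p)) = normc (G p) by case: (G p) => a b /=; rewrite sqrrN.
have := le_normcD (G w) (conjc (G p)).
have := le_normcD (G w - G p) (G p); rewrite subrK nJ.
move: H; lra.
Qed.

Lemma harnack_disc G p w (r : R) : 0 < r ->
  (forall x, normc (x - w) <= 2 * r -> holo G x) ->
  (forall x, normc (x - w) <= 2 * r -> 0 <= complex.Re (G x)) ->
  normc (w - p) <= r / 16 -> normc (G w) <= 3 * normc (G p).
Proof.
move=> r0 dG G0 wp; apply/ler_addgt0Pr => e e0.
have e4 : 0 < e / 4 by rewrite divr_gt0.
have : normc (G w + (e / 4)%:C%C) <= 3 * normc (G p + (e / 4)%:C%C).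
  apply: (@harnack_disc_pos (fun x => G x + (e / 4)%:C%C) p w r r0 _ _ wp) => x xr.
    by apply: holoD; [exact: dG|exact: holo_cst].
  by have := G0 x xr; case: (G x) => a b /=; lra.
have := le_normcD (G p) (e / 4)%:C%C.
have := le_normcB (G w + (e / 4)%:C%C) (e / 4)%:C%C.
rewrite addrK normc_real (gtr0_norm e4); lra.
Qed.

(** A chain of discs along the segment from [p] to [w]; [K] depends on the number
    of discs only. *)
Theorem harnack_half_plane p w : 0 < complex.Im p -> 0 < complex.Im w ->
  exists2 K : R, 0 < K & forall G,
    (forall z, 0 < complex.Im z -> holo G z) ->
    (forall z, 0 < complex.Im z -> 0 <= complex.Re (G z)) ->
    normc (G w) <= K * normc (G p).
Proof.
move=> p0 w0.
(* Discs of radius [2 * r = m / 2] around the points of the segment stay in the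
   upper half-plane. *)
pose m := Num.min (complex.Im p) (complex.Im w).
have m0 : 0 < m by rewrite lt_min p0.
pose r := m / 4; have r0 : 0 < r by rewrite divr_gt0.
have n0 := normc_ge0 (w - p).
have [|k] := @exists_exp2V_lt R (r / 16 / (normc (w - p) + 1)).
  by rewrite !divr_gt0 //; lra.
rewrite ltr_pdivlMr; last by lra.
set q := 2 ^- k => kq.
have q0 : 0 < q by rewrite invr_gt0 exprn_gt0.
exists (3 ^+ (2 ^ k)); first by rewrite exprn_gt0.
move=> G dG G0.
have line (t : R) : 0 <= t <= 1 -> m <= complex.Im (p + t%:C%C * (w - p)).
  have : m <= complex.Im p by rewrite ge_min lexx.
  have : m <= complex.Im w by rewrite ge_min lexx orbT.
  case: (p) => a b; case: (w) => c d /= bm dm; rewrite mul0r addr0.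
  by nra.
suff: forall j, (j <= 2 ^ k)%N -> normc (G (p + (j%:R * q)%:C%C * (w - p))) <= 3 ^+ j * normc (G p).
  move=> /(_ _ (leqnn _)); rewrite natrX divff ?rmorph1 ?mul1r ?gt_eqF ?exprn_gt0 //.
  by rewrite [p + _]addrC subrK.
elim=> [_|j IH jk]; first by rewrite mul0r mul0r addr0 expr0 mul1r.
rewrite exprS -mulrA; apply: le_trans (_ : 3 * normc (G (p + (j%:R * q)%:C%C * (w - p))) <= _); last first.
  by rewrite ler_pM2l // IH // ltnW.
have jb : 0 <= (j.+1%:R * q : R) <= 1.
  rewrite mulr_ge0 ?(ltW q0) //= ler_pdivrMr ?exprn_gt0 // mul1r -natrX ler_nat //.
have disc x : normc (x - (p + (j.+1%:R * q)%:C%C * (w - p))) <= 2 * r -> 0 < complex.Im x.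
  move: (line _ jb); set y := p + _ => yIm xy.
  have := le_trans (Im_le_normc _) xy; rewrite ler_norml => /andP[+ _].
  by rewrite raddfB /=; rewrite /r; lra.
apply: (@harnack_disc _ _ _ r) => // [x /disc/dG|x /disc/G0|] //.
have -> : p + (j.+1%:R * q)%:C%C * (w - p) - (p + (j%:R * q)%:C%C * (w - p)) = q%:C%C * (w - p).
  by rewrite -natr1 mulrDl mul1r rmorphD /=; ring.
rewrite normcM normc_real gtr0_norm //; apply/ltW/(le_lt_trans _ kq).
by rewrite ler_pM2l //; lra.
Qed.

End Harnack.

(** * Hilbert space: projection, representation, uniform boundedness *)

Section Hilbert.
Context {R : realType} {H : completeNormedModType R[i]}.
Variable dot : {dot H for Num.conj}.
Hypothesis dot_norm : norm_from_dot dot.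
Local Notation C := R[i].
Implicit Types (x y z : H) (a b : C).

(** The norm of a complex normed module takes values in [R[i]], where the order is
    partial. *)
Definition rnorm x : R := complex.Re `|x|.

Lemma rnormE x : `|x| = (rnorm x)%:C%C.
Proof. by rewrite /rnorm RRe_real // normr_real. Qed.

Lemma rnorm_ge0 x : 0 <= rnorm x.
Proof. by rewrite -ler0c -rnormE. Qed.

Lemma rnorm0 : rnorm 0 = 0.
Proof. by rewrite /rnorm normr0. Qed.

Lemma rnorm_eq0 x : (rnorm x == 0) = (x == 0).
Proof. by rewrite -(inj_eq (@complexI _)) -rnormE normr_eq0. Qed.

Lemma rnorm_gt0 x : (0 < rnorm x) = (x != 0).
Proof. by rewrite lt_def rnorm_ge0 andbT rnorm_eq0. Qed.

Lemma rnormN x : rnorm (- x) = rnorm x.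
Proof. by rewrite /rnorm normrN. Qed.

Lemma rnormD x y : rnorm (x + y) <= rnorm x + rnorm y.
Proof. by rewrite -lecR rmorphD /= -!rnormE ler_normD. Qed.

Lemma rnormB x y : rnorm (x - y) <= rnorm x + rnorm y.
Proof. by rewrite -(rnormN y) rnormD. Qed.

Lemma rnormZ a x : rnorm (a *: x) = normc a * rnorm x.
Proof. by apply: (@complexI R); rewrite rmorphM /= -!rnormE normrZ. Qed.

Lemma dotDl x y z : dot (x + y) z = dot x z + dot y z.
Proof. exact: linearDl. Qed.
Lemma dotDr x y z : dot x (y + z) = dot x y + dot x z.
Proof. exact: linearDr. Qed.
Lemma dotBl x y z : dot (x - y) z = dot x z - dot y z.
Proof. exact: linearBl. Qed.
Lemma dotBr x y z : dot x (y - z) = dot x y - dot x z.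
Proof. exact: linearBr. Qed.
Lemma dotZl a x y : dot (a *: x) y = a * dot x y.
Proof. exact: linearZl_LR. Qed.
Lemma dotZr a x y : dot x (a *: y) = a^* * dot x y.
Proof. exact: linearZr_LR. Qed.
Lemma dot0l x : dot 0 x = 0.
Proof. exact: linear0l. Qed.
Lemma dot0r x : dot x 0 = 0.
Proof. exact: linear0r. Qed.
Lemma dotC x y : dot x y = (dot y x)^*.
Proof. by rewrite (hermC dot) mul1r. Qed.

Lemma dotxx x : dot x x = (rnorm x ^+ 2)%:C%C.
Proof. by rewrite dot_norm rnormE rmorphXn. Qed.

Lemma rnorm_sqrD x y :
  rnorm (x + y) ^+ 2 = rnorm x ^+ 2 + rnorm y ^+ 2 + 2 * complex.Re (dot x y).
Proof.
apply: (@complexI R); rewrite -dotxx dotDl !dotDr !dotxx !rmorphD /=.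
rewrite (dotC y x); case: (dot x y) => a b.
by apply/eqP; rewrite eq_complex /=; apply/andP; split; apply/eqP; ring.
Qed.

Lemma rnorm_sqrB x y :
  rnorm (x - y) ^+ 2 = rnorm x ^+ 2 + rnorm y ^+ 2 - 2 * complex.Re (dot x y).
Proof.
by rewrite rnorm_sqrD rnormN -scaleN1r dotZr rmorphN rmorph1 mulN1r raddfN /= mulrN.
Qed.

Lemma cauchy_schwarz x y : normc (dot x y) <= rnorm x * rnorm y.
Proof.
have [->|y0] := eqVneq y 0; first by rewrite dot0r normc0 rnorm0 mulr0.
have N0 : 0 < rnorm y by rewrite rnorm_gt0.
pose N := rnorm y ^+ 2.
have NN : 0 < N by rewrite exprn_gt0.
have := sqr_ge0 (rnorm (N%:C%C *: x - dot x y *: y)).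
rewrite rnorm_sqrB !rnormZ !exprMn normc_real -/N dotZl dotZr.
have -> : complex.Re (N%:C%C * ((dot x y)^* * dot x y)) = N * normc (dot x y) ^+ 2.
  by rewrite normc_sqr; case: (dot x y) => a b /=; ring.
rewrite (gtr0_norm NN) => H1.
have : 0 <= N * (N * rnorm x ^+ 2 - normc (dot x y) ^+ 2) by move: H1; lra.
rewrite pmulr_rge0 // subr_ge0 => H2.
by rewrite -(@ler_pXn2r _ 2) ?nnegrE ?mulr_ge0 ?rnorm_ge0 ?normc_ge0 // exprMn mulrC.
Qed.

Lemma rnorm_complete (u : nat -> H) :
  (forall e : R, 0 < e -> exists N, forall m n, (N <= m)%N -> (N <= n)%N ->
     rnorm (u m - u n) < e) ->
  exists l, forall e : R, 0 < e -> exists N, forall n, (N <= n)%N -> rnorm (l - u n) < e.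
Proof.
move=> cu.
have uc : cauchy (u @ \oo).
  apply: cauchy_exP => -[e ei]; rewrite ltcE /= => /andP[/eqP -> e0].
  have [N HN] := cu e e0; exists (u N); exists N => // n /= Nn.
  by rewrite -ball_normE /= rnormE ltcR; apply: HN.
have uL : u n @[n --> \oo] --> lim (u n @[n --> \oo]) by exact: (@cauchy_cvg H (u @ \oo) _ uc).
have ul := (cvgrPdist_lt u _).1 uL.
exists (lim (u @ \oo)) => e e0.
have [|N _ HN] := ul _ e%:C%C; first by rewrite ltcR.
by exists N => n /HN; rewrite /= rnormE ltcR.
Qed.

Definition adherent (V : set H) x := forall e : R, 0 < e -> exists2 v, V v & rnorm (x - v) < e.

(** The point of best approximation; [V] is not assumed to be closed, so that
    [m] belongs to its closure. *)
Lemma projection (V : set H) x : V 0 -> (forall a v w, V v -> V w -> V (a *: v + w)) ->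
  exists2 m, adherent V m & forall v, V v -> dot (x - m) v = 0.
Proof.
move=> V0 VD.
pose D : set R := [set rnorm (x - v) | v in V].
have D0 : D !=set0 by exists (rnorm (x - 0)), 0.
have Dlb : lbound D 0 by move=> _ [v _ <-]; exact: rnorm_ge0.
have Dinf : has_inf D by split => //; exists 0.
pose d := inf D.
have dle v : V v -> d <= rnorm (x - v) by move=> Vv; apply: ge_inf; [exists 0|exists v].
have d0 : 0 <= d by apply: lb_le_inf.
have [|u uP] := @choice nat H (fun n v => V v /\ rnorm (x - v) < d + 2 ^- n).
  move=> n; have [|_ [v Vv <-] vd] := inf_adherent (_ : 0 < 2 ^- n :> R) Dinf.
    by rewrite invr_gt0 exprn_gt0.
  by exists v.
have VZ a v : V v -> V (a *: v) by move=> Vv; have := VD a v 0 Vv V0; rewrite addr0.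
(* The parallelogram identity, with the midpoint of [u m] and [u n] in [V]. *)
have close m n : rnorm (u m - u n) ^+ 2 <= 2 * rnorm (x - u m) ^+ 2 + 2 * rnorm (x - u n) ^+ 2 - 4 * d ^+ 2.
  have [Vm _] := uP m; have [Vn _] := uP n.
  have := dle _ (VZ 2^-1 _ (VD 1 _ _ Vm Vn)); rewrite scale1r => H1.
  have : 4 * d ^+ 2 <= rnorm (2 *: (x - 2^-1 *: (u m + u n))) ^+ 2.
    rewrite rnormZ exprMn normc2.
    rewrite (_ : 2 ^+ 2 = 4); last by ring.
    by rewrite ler_pM2l // ler_pXn2r ?nnegrE ?rnorm_ge0.
  have -> : 2 *: (x - 2^-1 *: (u m + u n)) = (x - u m) + (x - u n).
    rewrite scalerBr scalerA divff ?pnatr_eq0 // scale1r scaler_nat mulr2n opprD.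
    by rewrite addrACA.
  have -> : u m - u n = (x - u n) - (x - u m) by rewrite opprB [RHS]addrC addrA subrK.
  by rewrite (rnorm_sqrD (x - u m)) (rnorm_sqrB (x - u n)) (dotC (x - u n)); case: (dot _ _) => a b /=; lra.
have [|m mP] := @rnorm_complete u.
  move=> e e0.
  have e1 : 0 < e ^+ 2 / (8 * d + 4) by rewrite divr_gt0 ?exprn_gt0 //; lra.
  have [N] := exists_exp2V_lt e1; rewrite ltr_pdivlMr; last by lra.
  move=> HN; exists N => m n Nm Nn.
  rewrite -(@ltr_pXn2r _ 2) ?nnegrE ?rnorm_ge0 ?ltW //.
  apply: le_lt_trans (close m n) _; apply: le_lt_trans HN.
  have q (k : nat) : (N <= k)%N -> rnorm (x - u k) ^+ 2 <= d ^+ 2 + 2 * d * 2 ^- N + 2 ^- N.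
    move=> Nk; have [_ /ltW uk] := uP k.
    have qN : 2 ^- k <= 2 ^- N :> R.
      by rewrite lef_pV2 ?posrE ?exprn_gt0 // ler_eXn2l // ltr1n.
    have q1 : 2 ^- N <= 1 :> R by rewrite invf_le1 ?exprn_gt0 // exprn_ege1 // ler1n.
    have q0 : 0 <= 2 ^- N :> R by rewrite invr_ge0 exprn_ge0.
    apply: (@le_trans _ _ ((d + 2 ^- N) ^+ 2)).
      by rewrite ler_pXn2r ?nnegrE ?rnorm_ge0 ?addr_ge0 // (le_trans uk) // lerD2l.
    have : 2 ^- N * 2 ^- N <= 2 ^- N :> R by rewrite ler_piMl.
    by rewrite sqrrD expr2; lra.
  by have := q m Nm; have := q n Nn; lra.
have mV : adherent V m.
  move=> e e0; have [N HN] := mP e e0; exists (u N); [by case: (uP N)|exact: HN].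
exists m => // v Vv.
have far y : adherent V y -> d <= rnorm (x - y).
  move=> yV; apply/ler_addgt0Pr => e e0; have [w Vw wy] := yV e e0.
  apply: le_trans (dle w Vw) _.
  have -> : x - w = (x - y) + (y - w) by rewrite addrA subrK.
  by apply: le_trans (rnormD _ _) _; rewrite lerD2l ltW.
have near_m : rnorm (x - m) <= d.
  apply/ler_addgt0Pr => e e0.
  have e2 : 0 < e / 2 by rewrite divr_gt0.
  have [N HN] := mP _ e2; have [N' HN'] := exists_exp2V_lt e2.
  pose k := maxn N N'; have := HN k (leq_maxl _ _); have [_ uk] := uP k.
  have : 2 ^- k <= 2 ^- N' :> R.
    by rewrite lef_pV2 ?posrE ?exprn_gt0 // ler_eXn2l ?ltr1n // leq_maxr.
  have -> : x - m = (x - u k) - (m - u k) by rewrite opprB addrA subrK.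
  by move=> ? ?; apply: le_trans (rnormB _ _) _; move: HN'; lra.
have shift (t : C) : rnorm (x - m) <= rnorm ((x - m) - t *: v).
  apply: le_trans near_m _; rewrite -addrA -opprD; apply: far => e e0.
  have [w Vw wm] := mV e e0; exists (t *: v + w); first exact: VD.
  by rewrite opprD addrA addrK.
(* A step of length [s] in the direction of [dot (x - m) v *: v] would improve the
   approximation. *)
pose c := dot (x - m) v; pose s : R := (rnorm v ^+ 2 + 1)^-1.
have n0 := sqr_ge0 (rnorm v).
have s0 : 0 < s by rewrite invr_gt0; lra.
have := shift (s%:C%C * c).
rewrite -(@ler_pXn2r _ 2) ?nnegrE ?rnorm_ge0 // [in leRHS]rnorm_sqrB.
rewrite dotZr rnormZ normcM normc_real (gtr0_norm s0) -/c.
have -> : complex.Re ((s%:C%C * c)^* * c) = s * normc c ^+ 2.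
  by rewrite normc_sqr; case: (c) => a b /=; ring.
rewrite !exprMn => H1.
have sv : s * rnorm v ^+ 2 <= 1 by rewrite mulrC ler_pdivrMr; lra.
have c0 := sqr_ge0 (normc c).
have H2 : s * normc c ^+ 2 * (s * rnorm v ^+ 2) <= s * normc c ^+ 2.
  by rewrite ler_piMr // mulr_ge0 // ltW.
have : s * normc c ^+ 2 <= 0.
  have -> : s * normc c ^+ 2 = 2 * (s * normc c ^+ 2) - s * normc c ^+ 2 by ring.
  have : s ^+ 2 * normc c ^+ 2 * rnorm v ^+ 2 = s * normc c ^+ 2 * (s * rnorm v ^+ 2) by ring.
  lra.
rewrite pmulr_rle0 // => c1; apply/eqP; rewrite -normc_eq0.
by rewrite -sqrf_eq0 eq_le c0 c1.
Qed.

(** Take a vector on which [phi] does not vanish: the representing vector is a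
    multiple of its component orthogonal to the kernel of [phi]. *)
Lemma riesz (phi : H -> C) (M : R) : (forall a x y, phi (a *: x + y) = a * phi x + phi y) ->
  (forall x, normc (phi x) <= M * rnorm x) -> exists k, forall f, phi f = dot f k.
Proof.
move=> lin bnd.
have phi0 : phi 0 = 0 by have := lin (-1) 0 0; rewrite scaler0 addr0 mulN1r addNr.
case: (pselect (exists x, phi x != 0)) => [[y y0]|no]; last first.
  exists 0 => f; rewrite dot0r; apply/eqP; apply: contrapT => f0; apply: no.
  by exists f; apply/negP.
have M0 : 0 <= M.
  have := le_trans (normc_ge0 _) (bnd y); rewrite pmulr_lge0 // rnorm_gt0.
  by apply: contra_neq y0 => ->.
pose x := (phi y)^-1 *: y.
have phix : phi x = 1 by have := lin (phi y)^-1 y 0; rewrite addr0 phi0 addr0 mulVf.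
have phiN v w : phi (v - w) = phi v - phi w.
  by have := lin (-1) w v; rewrite scaleN1r mulN1r addrC => ->; rewrite addrC.
have [||m mV mO] := @projection [set v | phi v = 0] x.
- exact: phi0.
- by move=> a v w /= v0 w0; rewrite lin v0 w0 mulr0 addr0.
have phim : phi m = 0.
  apply/eqP; rewrite -normc_eq0 eq_le normc_ge0 andbT; apply/ler_addgt0Pr => e e0.
  have e1 : 0 < e / (M + 1) by rewrite divr_gt0 //; lra.
  have [v /= v0 vm] := mV _ e1.
  have -> : phi m = phi (m - v) by rewrite phiN v0 subr0.
  apply: le_trans (bnd _) _; rewrite add0r.
  move: vm; rewrite ltr_pdivlMr; last by lra.
  by have := rnorm_ge0 (m - v); lra.
pose r := x - m.
have phir : phi r = 1 by rewrite phiN phim phix subr0.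
have r0 : r != 0 by apply/eqP => r0; move: phir; rewrite r0 phi0 => /eqP; rewrite eq_sym oner_eq0.
have rn : (rnorm r ^+ 2)%:C%C != 0 :> C.
  by rewrite -[0]/(0%:C)%C (inj_eq (@complexI _)) sqrf_eq0 rnorm_eq0.
exists ((rnorm r ^- 2)%:C%C *: r) => f.
have : dot (f - phi f *: r) r = 0.
  rewrite dotC mO ?rmorph0 //=.
  by have := lin (- phi f) r f; rewrite phir mulr1 addNr scaleNr addrC.
rewrite dotBl dotZl dotxx => /eqP; rewrite subr_eq0 => /eqP fr.
rewrite dotZr fr.
have -> : ((rnorm r ^- 2)%:C%C : C)^* = (rnorm r ^- 2)%:C%C by exact: conjc_real.
by rewrite fmorphV /= mulrC mulfK.
Qed.

(** Sokal's proof of the uniform boundedness theorem.  If [y n] is in [A] with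
    [rnorm (y n)] large, one of the two signs in [u n.+1 = u n +/- e n] makes
    [|<u n.+1, y n>|] at least [3 ^- n * rnorm (y n)], and the steps after that one are
    too short to spoil it. *)
Lemma weakly_bounded (A : set H) :
  (forall x, exists M : R, forall y, A y -> normc (dot x y) <= M) ->
  exists2 M : R, 0 <= M & forall y, A y -> rnorm y <= M.
Proof.
move=> wb; apply: contrapT => nM.
have [|y yP] := @choice nat H (fun n y => A y /\ 2 * n%:R * 3 ^+ n < rnorm y).
  move=> n; apply: contrapT => ny; apply: nM; exists (2 * n%:R * 3 ^+ n).
    by rewrite !mulr_ge0 ?exprn_ge0.
  move=> y Ay; rewrite leNgt; apply/negP => H1; apply: ny; by exists y.
have y0 n : 0 < rnorm (y n).
  by have [_] := yP n; apply: le_lt_trans; rewrite !mulr_ge0 ?exprn_ge0.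
pose q n : R := 3 ^- n; have q0 n : 0 < q n by rewrite invr_gt0 exprn_gt0.
pose e n : H := (q n / rnorm (y n))%:C%C *: y n.
have en n : rnorm (e n) = q n.
  by rewrite rnormZ normc_real gtr0_norm ?divr_gt0 // divfK ?gt_eqF.
pose u := fix u n : H := if n is n'.+1 then
  (if q n' * rnorm (y n') <= normc (dot (u n' + e n') (y n')) then u n' + e n' else u n' - e n') else 0.
have uS n : rnorm (u n.+1 - u n) = q n.
  rewrite /=; case: ifP => _; first by rewrite addrAC subrr add0r en.
  by rewrite addrAC subrr add0r rnormN en.
have uy n : q n * rnorm (y n) <= normc (dot (u n.+1) (y n)).
  rewrite /=; case: ifP => // /negbT; rewrite -ltNge => lt1.
  have : normc (2 * dot (e n) (y n)) <= normc (dot (u n + e n) (y n)) + normc (dot (u n - e n) (y n)).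
    by rewrite [_ * dot (e n) _](_ : _ = dot (u n + e n) (y n) - dot (u n - e n) (y n)) ?le_normcB // dotDl dotBl; ring.
  rewrite normcM normc2.
  have -> : dot (e n) (y n) = (q n * rnorm (y n))%:C%C.
    by rewrite /e dotZl dotxx -rmorphM expr2 mulrA divfK ?gt_eqF.
  rewrite normc_real (ger0_norm (mulr_ge0 (ltW (q0 n)) (ltW (y0 n)))).
  by move: lt1; lra.
(* The geometric series of the steps, summed exactly. *)
have tail n m : rnorm (u (n + m)%N - u n) <= 3 / 2 * (q n - q (n + m)%N).
  elim: m => [|m IH]; first by rewrite addn0 !subrr rnorm0 mulr0.
  have -> : u (n + m.+1)%N - u n = (u (n + m).+1 - u (n + m)%N) + (u (n + m)%N - u n).
    by rewrite addrA subrK addnS.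
  apply: le_trans (rnormD _ _) _; rewrite uS addnS.
  have : q (n + m)%N = 3 * q (n + m).+1 by rewrite /q exprS invfM mulrA divff ?mul1r ?pnatr_eq0.
  by move: IH; lra.
have tail2 n m : (n <= m)%N -> rnorm (u m - u n) <= 3 / 2 * q n.
  by move=> nm; have := tail n (m - n)%N; rewrite subnKC //; have := q0 m; lra.
have q2 n : q n <= 2 ^- n.
  by rewrite lef_pV2 ?posrE ?exprn_gt0 //; apply: lerXn2r; rewrite ?nnegrE ?ler_nat.
have [|x xP] := @rnorm_complete u.
  move=> d d0; have d3 : 0 < d / 3 by rewrite divr_gt0.
  have [N HN] := exists_exp2V_lt d3; exists N => m n Nm Nn.
  have -> : u m - u n = (u m - u N) - (u n - u N) by rewrite opprB addrA subrK.
  have := tail2 N m Nm; have := tail2 N n Nn; have := q2 N.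
  move=> ? ? ?; apply: le_lt_trans (rnormB _ _) _; lra.
have xu n : rnorm (x - u n) <= 3 / 2 * q n.
  apply/ler_addgt0Pr => d d0; have [N HN] := xP d d0.
  have := tail2 n (maxn n N) (leq_maxl _ _); have := HN (maxn n N) (leq_maxr _ _).
  set k := maxn n N => h1 h2.
  have -> : x - u n = (x - u k) + (u k - u n) by rewrite addrA subrK.
  by apply: le_trans (rnormD _ _) _; lra.
have xy n : n%:R <= normc (dot x (y n)).
  have -> : dot x (y n) = dot (u n.+1) (y n) + dot (x - u n.+1) (y n) by rewrite dotBl addrC subrK.
  have := uy n; have := cauchy_schwarz (x - u n.+1) (y n).
  have := le_normcB (dot (u n.+1) (y n) + dot (x - u n.+1) (y n)) (dot (x - u n.+1) (y n)).
  rewrite addrK => h1 h2 h3.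
  have q3 : q n = 3 * q n.+1 by rewrite /q exprS invfM mulrA divff ?mul1r ?pnatr_eq0.
  have h4 : rnorm (x - u n.+1) * rnorm (y n) <= q n / 2 * rnorm (y n).
    apply: (ler_wpM2r (ltW (y0 n))); apply: le_trans (xu _) _; rewrite q3; lra.
  have [_ h5] := yP n.
  have h6 : n%:R <= q n / 2 * rnorm (y n).
    have -> : n%:R = q n / 2 * (2 * n%:R * 3 ^+ n) :> R.
      by rewrite /q; field; rewrite expf_neq0 ?pnatr_eq0.
    by rewrite ler_pM2l ?divr_gt0 //; apply: ltW.
  lra.
have [M HM] := wb x.
have [Ay _] := yP (Num.truncn M).+1.
have := le_trans (xy _) (HM _ Ay).
by rewrite leNgt truncnS_gt.
Qed.

End Hilbert.

(** * Linear relations and their adjoints *)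

Section Relations.
Context {R : realType} {H : completeNormedModType R[i]}.
Variable dot : {dot H for Num.conj}.
Hypothesis dot_norm : norm_from_dot dot.
Local Notation C := R[i].
Implicit Types (x y z f g h k : H) (a b : C) (T S : set (H * H)).

Lemma linear_at0 (A : H -> H) : linear A -> A 0 = 0.
Proof. by move=> linA; have := linA (-1) 0 0; rewrite scaler0 addr0 scaleN1r addNr. Qed.

Lemma opnorm_leP (A : H -> H) (M : R) :
  opnorm_le A M <-> forall x, rnorm (A x) <= M * rnorm x.
Proof.
by split=> AM x; have := AM x; rewrite !rnormE -rmorphM lecR.
Qed.

Lemma adjointP (A : H -> H) : bounded_operator A ->
  forall h f, dot (adjoint dot A h) f = dot h (A f).
Proof.
move=> [linA [M /opnorm_leP AM]] h f.
have [|x|k kP] := @riesz _ _ dot dot_norm (fun x => dot (A x) h) (M * rnorm h).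
- by move=> a x y; rewrite linA dotDl dotZl.
- by apply: le_trans (cauchy_schwarz dot_norm _ _) _; rewrite mulrAC ler_wpM2r ?rnorm_ge0.
have ex : exists k, [set k | rel_adjoint dot (graph A) (h, k)] k.
  exists k => f' g; rewrite /graph /= => ->.
  by rewrite dotC -kP -dotC.
by have /(_ f (A f) erefl) := xgetPex 0 ex.
Qed.

(** The lower bound makes the range closed, as [T = S^*] is closed, and
    [(ran T)^perp = ker S] makes it dense. *)
Lemma bounded_below_in_BH T S (M : R) : linear_relation T ->
  rel_adjoint dot S = T -> rel_adjoint dot T = S ->
  (forall f g, T (f, g) -> rnorm f <= M * rnorm g) ->
  (forall h, S (h, 0) -> h = 0) -> in_BH (rel_inv T).
Proof.
move=> [T0 TD] ST TS TM S0.
have M0 : 0 <= `|M| + 1 by rewrite addr_ge0.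
have {}TM f g : T (f, g) -> rnorm f <= (`|M| + 1) * rnorm g.
  move=> /TM /le_trans; apply; rewrite ler_wpM2r ?rnorm_ge0 //.
  by have := ler_norm M; lra.
have TB f g f' g' : T (f, g) -> T (f', g') -> T (f - f', g - g').
  move=> t1 t2; have := TD (-1) _ _ t2 t1.
  rewrite -[_ + _]/(-1 *: f' + f, -1 *: g' + g) !scaleN1r.
  by rewrite [- f' + f]addrC [- g' + g]addrC.
have onto x : exists f, T (f, x).
  have [||m mV mO] := @projection _ _ dot dot_norm (rel_ran T) x.
  - by exists 0.
  - by move=> a v w [f1 t1] [f2 t2]; exists (a *: f1 + f2); apply: (TD a _ _ t1 t2).
  have xm : x - m = 0.
    apply: S0; rewrite -TS => f g Tfg /=; rewrite dot0l mO //; by exists f.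
  have {xm mO} -> : x = m by apply/eqP; rewrite -subr_eq0 xm.
  have [|fg fgP] := @choice nat (H * H)%type (fun n p => T p /\ rnorm (m - p.2) < 2 ^- n).
    move=> n; have [|g [f Tfg] gm] := mV (2 ^- n); first by rewrite invr_gt0 exprn_gt0.
    by exists (f, g).
  have q2 (n N : nat) : (N <= n)%N -> 2 ^- n <= 2 ^- N :> R.
    by move=> nN; rewrite lef_pV2 ?posrE ?exprn_gt0 // ler_eXn2l // ltr1n.
  have [|l lP] := @rnorm_complete _ _ (fun n => (fg n).1).
    move=> e e0; have e1 : 0 < e / (2 * (`|M| + 1) + 1) by rewrite divr_gt0 //; lra.
    have [N] := exists_exp2V_lt e1; rewrite ltr_pdivlMr; last by lra.
    move=> HN; exists N => i j Ni Nj.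
    have [Ti gi] := fgP i; have [Tj gj] := fgP j.
    apply: le_lt_trans (TM _ ((fg i).2 - (fg j).2) _) _.
      by apply: TB; rewrite -surjective_pairing.
    have : rnorm ((fg i).2 - (fg j).2) <= 2 * 2 ^- N.
      have -> : (fg i).2 - (fg j).2 = (m - (fg j).2) - (m - (fg i).2).
        by rewrite opprB [RHS]addrC addrA subrK.
      by have := q2 _ _ Ni; have := q2 _ _ Nj => ? ?; apply: le_trans (rnormB _ _) _; lra.
    move=> /(ler_wpM2l M0) /le_lt_trans; apply; apply: le_lt_trans HN.
    have : 0 <= 2 ^- N :> R by rewrite invr_ge0 exprn_ge0.
    lra.
  exists l; rewrite -ST => h k Shk /=.
  apply/eqP; rewrite -subr_eq0 -normc_eq0 eq_le normc_ge0 andbT.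
  apply/ler_addgt0Pr => e e0; rewrite add0r.
  have h0 := rnorm_ge0 h; have k0 := rnorm_ge0 k.
  have e1 : 0 < e / (rnorm h + rnorm k + 1) by rewrite divr_gt0 //; lra.
  have [N HN] := lP _ e1; have [N' HN'] := exists_exp2V_lt e1.
  pose n := maxn N N'.
  have ln := ltW (HN n (leq_maxl _ _)).
  have mn : rnorm (m - (fg n).2) <= e / (rnorm h + rnorm k + 1).
    by apply: ltW; apply: lt_le_trans (fgP n).2 _; apply: le_trans (q2 _ _ (leq_maxr _ _)) (ltW HN').
  have : rel_adjoint dot S (fg n) by rewrite ST; case: (fgP n).
  move=> /(_ h k Shk) adj.
  have -> : dot m h - dot l k = dot (m - (fg n).2) h - dot (l - (fg n).1) k.
    by rewrite !dotBl adj; ring.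
  apply: le_trans (le_normcB _ _) _.
  have := cauchy_schwarz dot_norm (m - (fg n).2) h.
  have := cauchy_schwarz dot_norm (l - (fg n).1) k.
  have := ler_wpM2r h0 mn; have := ler_wpM2r k0 ln.
  have : e / (rnorm h + rnorm k + 1) * (rnorm h + rnorm k + 1) = e by rewrite divfK // gt_eqF // ltr_wpDl // addr_ge0.
  have := ltW e1; move: (e / _) => d; lra.
have [A AP] := @choice H H (fun x f => T (f, x)) onto.
have uni f x : T (f, x) -> f = A x.
  move=> Tfx; apply/eqP; rewrite -subr_eq0 -rnorm_eq0 eq_le rnorm_ge0 andbT.
  by have := TM _ _ (TB _ _ _ _ Tfx (AP x)); rewrite subrr rnorm0 mulr0.
exists A.
  split=> [a x y|]; first by apply/esym/uni; exact: (TD a _ _ (AP x) (AP y)).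
  by exists (`|M| + 1); apply/opnorm_leP => x; exact: TM.
apply/seteqP; split=> -[x f] /=; rewrite /graph /=; first exact: uni.
by move=> ->; exact: AP.
Qed.

(** If [T (f, x)] and [S (h, k)], then [<h, x> = <k, f>]; so the [h] with
    [rnorm k <= 1] form a weakly bounded set. *)
Lemma surjective_bounded_below T S : S `<=` rel_adjoint dot T -> linear_relation S ->
  rel_ran T = setT ->
  exists2 M : R, 0 <= M & forall h k, S (h, k) -> rnorm h <= M * rnorm k.
Proof.
move=> ST [S0 SD] Tonto.
have [x|M M0 HM] := @weakly_bounded _ _ dot dot_norm
    [set h | exists2 k, S (h, k) & rnorm k <= 1].
  have [f Tfx] : rel_ran T x by rewrite Tonto.
  exists (rnorm f) => h [k Shk k1].
  have -> : dot x h = (dot k f)^*.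
    by have /= kf := ST _ Shk _ _ Tfx; rewrite kf; exact: dotC.
  rewrite -dotC; apply: le_trans (cauchy_schwarz dot_norm _ _) _.
  by rewrite ler_piMr ?rnorm_ge0.
exists M => // h k Shk; apply/ler_addgt0Pr => e e0.
pose c := rnorm k + e / (M + 1).
have d0 : 0 < e / (M + 1) by rewrite divr_gt0 //; lra.
have c0 : 0 < c by have := rnorm_ge0 k; rewrite /c; lra.
have : rnorm ((c^-1)%:C%C *: h) <= M.
  apply: HM; exists ((c^-1)%:C%C *: k).
    by have := SD (c^-1)%:C%C _ _ Shk S0; rewrite addr0.
  rewrite rnormZ normc_real gtr0_norm ?invr_gt0 // mulrC ler_pdivrMr // mul1r.
  by rewrite lerDl ltW.
rewrite rnormZ normc_real gtr0_norm ?invr_gt0 // mulrC ler_pdivrMr // => /le_trans; apply.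
rewrite /c mulrDr lerD2l mulrA ler_pdivrMr; last by lra.
by rewrite mulrC ler_pM2l //; lra.
Qed.

Lemma dense_ran T S : linear_relation T -> rel_adjoint dot T = S ->
  (forall h, S (h, 0) -> h = 0) -> dense (rel_ran T).
Proof.
move=> [T0 TD] TS S0 O [x Ox] Oopen.
have [||m mV mO] := @projection _ _ dot dot_norm (rel_ran T) x.
- by exists 0.
- by move=> a v w [f1 t1] [f2 t2]; exists (a *: f1 + f2); apply: (TD a _ _ t1 t2).
have xm : x - m = 0.
  apply: S0; rewrite -TS => f g Tfg /=; rewrite dot0l mO //; by exists f.
have {xm mO} xm : x = m by apply/eqP; rewrite -subr_eq0 xm.
have : nbhs x O by apply: open_nbhs_nbhs.
move=> /nbhs_normP[[e ei]] /=; rewrite ltcE /= => /andP[/eqP -> e0] eO.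
rewrite -xm in mV; have [v Tv xv] := mV e e0.
by exists v; split => //; apply: eO; rewrite /= rnormE ltcR.
Qed.

End Relations.

(** * Cayley transforms of a Nevanlinna family *)

Section Family.
Context {R : realType} {H : completeNormedModType R[i]}.
Variable dot : {dot H for Num.conj}.
Hypothesis dot_norm : norm_from_dot dot.
Local Notation C := R[i].
Implicit Types (x y f g h k : H) (z p w : C) (T S : set (H * H)).
Local Notation holo f z := (derivable ((f : C -> C) : C^o -> C^o) z 1).

Lemma upperP z : upper_half_plane z <-> 0 < complex.Im z.
Proof. by rewrite /upper_half_plane /= -complexIm ltcR. Qed.

Lemma lowerP z : lower_half_plane z <-> complex.Im z < 0.
Proof. by rewrite /lower_half_plane /= -complexIm ltcR. Qed.

Lemma nonrealP z : nonreal z <-> complex.Im z != 0.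
Proof. by rewrite /nonreal /= -complexIm -[0]/(0%:C)%C (inj_eq (@complexI _)). Qed.

Lemma nonreal_conj z : nonreal z -> nonreal z^*.
Proof. by rewrite !nonrealP; case: z => a b /=; rewrite oppr_eq0. Qed.

Lemma holo_dot (Omega : set C) (G : C -> H -> H) z x k : holomorphic_on Omega G -> Omega z ->
  holo (fun zeta => dot (G zeta x) k) z.
Proof.
move=> [_ dG] /dG [D _ DP].
apply: (@eps_derivable _ _ _ (dot (D x) k)) => e e0.
have c0 : 0 < rnorm x * rnorm k + 1 by rewrite ltr_wpDl // mulr_ge0 ?rnorm_ge0.
have := DP (e / (rnorm x * rnorm k + 1)) (divr_gt0 e0 c0).
rewrite near_withinE => /nbhs_normP[[del di]] /=.
rewrite ltcE /= => /andP[/eqP ->] del0 Hd.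
exists del => // w wz.
have [->|wz0] := eqVneq w z; first by rewrite !subrr mulr0 subr0 normc0 mulr0.
have := Hd w; rewrite /= distrC normr_normc ltcR => /(_ wz wz0) /opnorm_leP /(_ x) Hx.
have wz1 : w - z != 0 by rewrite subr_eq0.
have -> : dot (G w x) k - dot (G z x) k - dot (D x) k * (w - z)
    = (w - z) * dot ((w - z)^-1 *: (G w x - G z x) - D x) k.
  by rewrite !dotBl dotZl !dotBl [RHS]mulrBr [in RHS]mulrA divff // mul1r; ring.
rewrite normcM mulrC ler_wpM2r ?normc_ge0 //.
apply: le_trans (cauchy_schwarz dot_norm _ _) _.
apply: (@le_trans _ _ (e / (rnorm x * rnorm k + 1) * rnorm x * rnorm k)).
  by rewrite ler_wpM2r ?rnorm_ge0.
rewrite -mulrA mulrAC ler_pdivrMr // ler_pM2l //; lra.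
Qed.

Lemma resolvent_graph T w (A : H -> H) : rel_inv (rel_shift T (- w)) = graph A ->
  (forall f g, T (f, g) -> A (g + w *: f) = f) /\ (forall x, T (A x, x - w *: A x)).
Proof.
move=> TA; split=> [f g Tfg|x].
  have : rel_inv (rel_shift T (- w)) (g + w *: f, f).
    by exists f, g; rewrite scaleNr opprK.
  by rewrite TA.
have : rel_inv (rel_shift T (- w)) (x, A x) by rewrite TA.
move=> [f [g [Tfg [-> ->]]]].
by rewrite scaleNr opprK addrK.
Qed.

(** This identity makes the Cayley transform of a dissipative relation a
    contraction, isometric exactly on the pairs with [Im <g, f> = 0]. *)
Lemma cayley_norm f g w :
  rnorm (g + w *: f) ^+ 2 - rnorm (g + w^* *: f) ^+ 2 = 4 * complex.Im w * complex.Im (dot g f).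
Proof.
rewrite !(rnorm_sqrD dot_norm) !rnormZ !dotZr.
have -> : normc w^* = normc w by case: (w) => a b /=; rewrite sqrrN.
by case: (w) => a b; case: (dot g f) => c d /=; ring.
Qed.

Lemma subJ_neq0 w : complex.Im w != 0 -> w - w^* != 0.
Proof.
case: w => a b /= b0; rewrite eq_complex /= subrr eqxx /= opprK.
by rewrite -mulr2n mulrn_eq0.
Qed.

(** Cauchy-Schwarz for the semidefinite form [Im <g, f>]: moving along a neutral
    vector would otherwise change its sign. *)
Lemma semidefinite_isotropic T (s : R) f g : linear_relation T ->
  (forall f' g', T (f', g') -> 0 <= s * complex.Im (dot g' f')) -> s != 0 ->
  T (f, g) -> complex.Im (dot g f) = 0 -> rel_adjoint dot T (f, g).
Proof.
move=> [T0 TD] Ts s0 Tfg gf0 f' g' Tfg' /=.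
pose c := dot g f' - dot f g'.
suff /eqP : c = 0 by rewrite subr_eq0 => /eqP.
apply/eqP; rewrite -normc_eq0 -sqrf_eq0; apply/negPn/negP => c0.
pose q := complex.Im (dot g' f').
(* This real [t] brings the form, multiplied by [s], down to -1. *)
pose t : R := - (q + s^-1) / normc c ^+ 2.
have := Ts _ _ (TD (t%:C%C * ('i%C * c^*)) _ _ Tfg Tfg').
have key (t' : R) (c' : C) : dot g f' = c' + dot f g' ->
   complex.Im (dot ((t'%:C%C * ('i%C * c'^*)) *: g + g') ((t'%:C%C * ('i%C * c'^*)) *: f + f'))
   = q + t' * normc c' ^+ 2.
  move=> E; rewrite dotDl !dotDr !dotZl !dotZr (dotC dot g' f) E normc_sqr /q.
  move: gf0; case: (dot g f) => x1 x2 /= ->.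
  case: c' E => c1 c2 _; case: (dot f g') => y1 y2; case: (dot g' f') => z1 z2 /=; ring.
rewrite key ?subrK // divfK // opprD addrA subrr add0r mulrN divff //.
by rewrite oppr_ge0 leNgt ltr01.
Qed.

Variable F : C -> set (H * H).
Hypothesis familyF : nevanlinna_family dot F.

Lemma family_sign z f g : nonreal z -> F z (f, g) ->
  0 <= complex.Im z * complex.Im (dot g f).
Proof.
move=> /nonrealP z0 Fz; have [zlt|zgt|z00] := ltgtP (complex.Im z) 0.
- have /lowerP zl := zlt; have [/(_ f g Fz) + _] := nf_accumulative familyF zl.
  by rewrite -complexIm lecR => ?; rewrite mulr_le0 // ltW.
- have /upperP zu := zgt; have [/(_ f g Fz) + _] := nf_dissipative familyF zu.
  by rewrite -complexIm ler0c => ?; rewrite mulr_ge0 // ltW.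
- by rewrite z00 eqxx in z0.
Qed.

Definition neutral_in T f g := T (f, g) /\ complex.Im (dot g f) = 0.

(** A neutral pair is isotropic, so it lies in the adjoint [(F z)^* = F z^*]. *)
Lemma neutral_conj z f g : nonreal z -> neutral_in (F z) f g -> neutral_in (F z^*) f g.
Proof.
move=> znr [Fz q0]; split=> //; rewrite -(nf_adjoint familyF znr).
have /nonrealP z0 := znr.
apply: (semidefinite_isotropic (nf_linear familyF znr) _ z0 Fz q0) => f' g'.
exact: family_sign.
Qed.

(** The upper half-plane and conjugation reach every pair of nonreal points. *)
Lemma transport (P : C -> Prop) :
  (forall p z, upper_half_plane p -> upper_half_plane z -> P p -> P z) ->
  (forall z, nonreal z -> P z -> P z^*) ->
  forall z z', nonreal z -> nonreal z' -> P z -> P z'.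
Proof.
move=> Pup Pconj z z' znr z'nr.
have up (u : C) : nonreal u -> ~ upper_half_plane u -> upper_half_plane u^*.
  move=> /nonrealP u0 nu; apply/upperP.
  have u1 : complex.Im u <= 0 by rewrite leNgt; apply/negP => /upperP.
  by move: u0 u1; case: (u) => a b /= b0 b1; rewrite oppr_gt0 lt_neqAle b0.
have conjK' (u : C) : u^*^* = u by exact: conjcK.
case: (pselect (upper_half_plane z)) => zu; case: (pselect (upper_half_plane z')) => z'u.
- exact: Pup.
- move=> /(Pup _ _ zu (up _ z'nr z'u))/(Pconj _ (nonreal_conj z'nr)).
  by rewrite conjK'.
- by move=> /(Pconj _ znr); apply: Pup => //; exact: up.
- move=> /(Pconj _ znr)/(Pup _ _ (up _ znr zu) (up _ z'nr z'u))/(Pconj _ (nonreal_conj z'nr)).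
  by rewrite conjK'.
Qed.

Definition cayley w (G : C -> H -> H) z x := x - (w - w^*) *: G z x.

Lemma cayley_components w f g (B : R) : w - w^* != 0 ->
  rnorm (g + w *: f) <= B -> rnorm (g + w^* *: f) <= B ->
  rnorm f <= 2 / normc (w - w^*) * B /\ rnorm g <= (1 + 2 * normc w / normc (w - w^*)) * B.
Proof.
move=> w0 xB yB.
have n0 : 0 < normc (w - w^*) by rewrite normc_gt0.
have fB : normc (w - w^*) * rnorm f <= 2 * B.
  rewrite -rnormZ.
  have -> : (w - w^*) *: f = (g + w *: f) - (g + w^* *: f).
    by rewrite scalerBl opprD addrACA subrr add0r.
  by apply: le_trans (rnormB _ _) _; lra.
have fB' : rnorm f <= 2 / normc (w - w^*) * B.
  by rewrite mulrAC ler_pdivlMr // mulrC.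
split=> //.
have -> : g = (g + w *: f) - w *: f by rewrite addrK.
apply: le_trans (rnormB _ _) _; rewrite rnormZ mulrDl mul1r lerD //.
have := ler_wpM2l (normc_ge0 w) fB'; congr (_ <= _); ring.
Qed.

Section Upper.
Variables (w : C) (G : C -> H -> H).
Hypothesis w_upper : upper_half_plane w.
Hypothesis holoG : holomorphic_on upper_half_plane G.
Hypothesis resG : forall z, upper_half_plane z ->
  rel_inv (rel_shift (F z) (- w)) = graph (G z).
Local Notation Th := (cayley w G).

Let upper_nonreal z : upper_half_plane z -> nonreal z.
Proof. by move=> /upperP z0; apply/nonrealP; rewrite gt_eqF. Qed.

Lemma cayleyE z f g : upper_half_plane z -> F z (f, g) -> Th z (g + w *: f) = g + w^* *: f.
Proof.
move=> zu Fz; have [/(_ _ _ Fz) GE _] := resolvent_graph (resG zu).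
by rewrite /cayley GE scalerBl opprB [w^* *: f - _]addrC addrA addrK.
Qed.

Lemma cayley_onto z x : upper_half_plane z -> exists f g, F z (f, g) /\ x = g + w *: f.
Proof.
move=> zu; have [_ /(_ x) Fx] := resolvent_graph (resG zu).
by exists (G z x), (x - w *: G z x); rewrite subrK.
Qed.

Lemma cayley_contraction z x : upper_half_plane z -> rnorm (Th z x) <= rnorm x.
Proof.
move=> zu; have [f [g [Fz ->]]] := cayley_onto x zu.
rewrite (cayleyE zu Fz) -(@ler_pXn2r _ 2) ?nnegrE ?rnorm_ge0 // -subr_ge0 cayley_norm.
have := family_sign (upper_nonreal zu) Fz.
have /upperP z0 := zu; rewrite pmulr_rge0 // => q0.
by move/upperP: w_upper => w0; rewrite mulr_ge0 // mulr_ge0 // ltW.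
Qed.

Lemma harnack_cayley p z : upper_half_plane p -> upper_half_plane z ->
  exists2 K : R, 0 < K & forall x k,
    normc ((rnorm x * rnorm k)%:C%C - dot (Th p x) k) <=
    K * normc ((rnorm x * rnorm k)%:C%C - dot (Th z x) k).
Proof.
move=> /upperP pu /upperP zu.
have [K K0 HK] := @harnack_half_plane R z p zu pu.
exists K => // x k.
apply: (HK (fun zeta => (rnorm x * rnorm k)%:C%C - dot (Th zeta x) k)) => u u0.
  apply: holoB; first exact: holo_cst.
  suff -> : (fun zeta => dot (Th zeta x) k) = (fun zeta => dot x k - (w - w^*) * dot (G zeta x) k).
    apply: holoB; first exact: holo_cst.
    apply: (@holoM _ (fun=> w - w^*)); first exact: holo_cst.
    by apply: holo_dot holoG _; apply/upperP.
  by apply/funext => zeta; rewrite /cayley dotBl dotZl.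
have /upperP uu := u0.
have := le_trans (Re_le_normc _) (cauchy_schwarz dot_norm (Th u x) k).
rewrite ler_norml => /andP[_ h1].
have h2 : rnorm (Th u x) * rnorm k <= rnorm x * rnorm k.
  by rewrite ler_wpM2r ?rnorm_ge0 ?cayley_contraction.
by move: h1 h2; rewrite raddfB /=; lra.
Qed.

(** Here [Th p] is isometric at [x = g + w f], so the function in
    [harnack_cayley] vanishes for [k = Th p x]; equality in Cauchy-Schwarz then
    forces [Th z x = k]. *)
Lemma neutral_upper p z f g : upper_half_plane p -> upper_half_plane z ->
  neutral_in (F p) f g -> neutral_in (F z) f g.
Proof.
move=> pu zu [Fp q0]; split=> //.
pose x := g + w *: f; pose k := g + w^* *: f.
have xk : rnorm x = rnorm k.
  have := cayley_norm f g w; rewrite q0 mulr0 => /eqP; rewrite subr_eq0.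
  by rewrite eqrXn2 ?rnorm_ge0 // => /eqP.
have [K K0 /(_ x k)] := harnack_cayley zu pu.
rewrite (cayleyE pu Fp) -/k (dotxx dot_norm) xk -expr2 subrr normc0 mulr0 => H1.
have {H1} /eqP : normc ((rnorm k ^+ 2)%:C%C - dot (Th z x) k) = 0.
  by apply/eqP; rewrite eq_le H1 normc_ge0.
rewrite normc_eq0 subr_eq0 => /eqP H1.
have Tk : Th z x = k.
  apply/eqP; rewrite -subr_eq0 -rnorm_eq0 -sqrf_eq0 eq_le sqr_ge0 andbT.
  rewrite (rnorm_sqrB dot_norm) -H1 /=.
  have : rnorm (Th z x) ^+ 2 <= rnorm k ^+ 2.
    by rewrite -xk ler_pXn2r ?nnegrE ?rnorm_ge0 ?cayley_contraction.
  lra.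
have [f' [g' [Fz xE]]] := cayley_onto x zu.
have kE : k = g' + w^* *: f' by rewrite -Tk xE (cayleyE zu Fz).
have w0 : w - w^* != 0 by apply: subJ_neq0; rewrite gt_eqF //; apply/upperP.
have ff : f' = f.
  apply: (scalerI w0).
  have d (h l : H) : (w - w^*) *: h = (l + w *: h) - (l + w^* *: h).
    by rewrite scalerBl opprD addrACA subrr add0r.
  by rewrite (d f' g') (d f g) -xE -kE.
have gg : g' = g by move: xE; rewrite /x ff => /addIr.
by rewrite -ff -gg.
Qed.

Let w0 : w - w^* != 0.
Proof. by apply: subJ_neq0; rewrite gt_eqF //; apply/upperP. Qed.

(** With [gam = - a] and [del = 1] this says that [T - a] has a bounded inverse on
    its range, with [gam = 1] and [del = 0] that [T] is a bounded operator on its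
    domain. *)
Definition comb_bounded (gam del : R) T := exists2 M : R, 0 <= M & forall f g, T (f, g) ->
  rnorm f <= M * rnorm (gam%:C%C *: f + del%:C%C *: g) /\
  rnorm g <= M * rnorm (gam%:C%C *: f + del%:C%C *: g).

(** Put [alpha = gam - del w^*], [x = g + w f] and [y = g + w^* f].  Then
    [alpha x - alpha^* y = (w - w^* ) (gam f + del g)]; since [gam] and [del] are
    real, [kap = alpha / alpha^*] is unimodular.  So the estimate amounts to a
    lower bound for [kap - Th z], that is, [kap] is not an approximate
    eigenvalue of the contraction [Th z], and [harnack_cayley] with
    [k = kap x] transfers it. *)
Lemma comb_bounded_upper gam del p z : (gam != 0) || (del != 0) ->
  upper_half_plane p -> upper_half_plane z ->
  comb_bounded gam del (F p) -> comb_bounded gam del (F z).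
Proof.
move=> gd0 pu zu [M M0 HM].
pose alpha := gam%:C%C - del%:C%C * w^*.
have alpha0 : alpha != 0.
  have w1 : complex.Im w != 0 by rewrite gt_eqF //; apply/upperP.
  have ImE : complex.Im alpha = del * complex.Im w by rewrite /alpha; case: (w) => a b /=; ring.
  have ReE : complex.Re alpha = gam - del * complex.Re w by rewrite /alpha; case: (w) => a b /=; ring.
  apply/negP => /eqP al0; move: ImE ReE; rewrite al0 /= => /esym/eqP.
  rewrite mulf_eq0 (negbTE w1) orbF => /eqP d0; rewrite d0 mul0r subr0 => g0.
  by move: gd0; rewrite d0 -g0 eqxx.
have alphaJ : alpha^* = gam%:C%C - del%:C%C * w.
  rewrite /alpha; case: (w) => a b; apply/eqP; rewrite eq_complex /=; apply/andP; split; apply/eqP; ring.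
have alphaJ0 : alpha^* != 0 by rewrite conjC_eq0.
pose kap := alpha / alpha^*.
have kap1 : normc kap = 1.
  rewrite normcM normcV; have -> : normc alpha^* = normc alpha by case: (alpha) => a b /=; rewrite sqrrN.
  by rewrite divff // normc_eq0.
pose rho := (w - w^*) / alpha^*.
have rho0 : 0 < normc rho by rewrite normc_gt0 mulf_neq0 // invr_eq0.
have comb f g : kap *: (g + w *: f) - (g + w^* *: f) = rho *: (gam%:C%C *: f + del%:C%C *: g).
  apply: (scalerI alphaJ0); rewrite scalerBr !scalerA.
  rewrite [alpha^* * kap]mulrC [alpha^* * rho]mulrC !divfK // !scalerDr !scalerA.
  rewrite opprD addrACA -!scalerBl addrC; congr (_ *: _ + _ *: _); rewrite alphaJ /alpha; ring.
pose A := M * (1 + normc w) / normc rho.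
have A0 : 0 <= A by rewrite divr_ge0 ?mulr_ge0 ?addr_ge0 ?normc_ge0.
have pA x : rnorm x <= A * rnorm (kap *: x - Th p x).
  have [f [g [Fp ->]]] := cayley_onto x pu.
  rewrite (cayleyE pu Fp) comb rnormZ mulrA /A divfK ?gt_eqF //.
  have [fM gM] := HM f g Fp.
  apply: le_trans (rnormD _ _) _; rewrite rnormZ.
  have := ler_wpM2l (normc_ge0 w) fM; lra.
have [K K0 HK] := harnack_cayley pu zu.
have xx x : dot (kap *: x) (kap *: x) = (rnorm x * rnorm x)%:C%C.
  by rewrite (dotxx dot_norm) rnormZ kap1 mul1r expr2.
have KA0 : 0 <= 2 * K * A ^+ 2 by rewrite mulr_ge0 ?sqr_ge0 // mulr_ge0 // ltW.
have zB x : rnorm x <= 2 * K * A ^+ 2 * rnorm (kap *: x - Th z x).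
  have [->|x0] := eqVneq x 0.
    by rewrite rnorm0 mulr_ge0 ?rnorm_ge0.
  have nx : 0 < rnorm x by rewrite rnorm_gt0.
  rewrite -(ler_pM2r nx).
  have h1 := HK x (kap *: x).
  rewrite rnormZ kap1 mul1r -xx -!dotBl in h1.
  have h2 := cauchy_schwarz dot_norm (kap *: x - Th z x) (kap *: x).
  rewrite rnormZ kap1 mul1r in h2.
  have h3 : rnorm (kap *: x - Th p x) ^+ 2 <= 2 * normc (dot (kap *: x - Th p x) (kap *: x)).
    rewrite (rnorm_sqrB dot_norm) (dotC dot (kap *: x)) rnormZ kap1 mul1r.
    have := le_trans (ler_norm _) (Re_le_normc (dot (kap *: x - Th p x) (kap *: x))).
    rewrite dotBl xx raddfB /= -expr2.
    have : rnorm (Th p x) ^+ 2 <= rnorm x ^+ 2.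
      by rewrite ler_pXn2r ?nnegrE ?rnorm_ge0 ?cayley_contraction.
    by case: (dot (Th p x) (kap *: x)) => a b /=; lra.
  have h4 : rnorm x * rnorm x <= A ^+ 2 * rnorm (kap *: x - Th p x) ^+ 2.
    have Ap : 0 <= A * rnorm (kap *: x - Th p x) by rewrite mulr_ge0 ?rnorm_ge0.
    by rewrite -expr2 -exprMn ler_pXn2r ?nnegrE ?rnorm_ge0.
  have h5 := ler_wpM2l (ltW K0) h2.
  have h6 : rnorm (kap *: x - Th p x) ^+ 2 <= 2 * (K * (rnorm (kap *: x - Th z x) * rnorm x)).
    by move: h1 h3 h5; lra.
  apply: (le_trans h4); apply: (le_trans (ler_wpM2l (sqr_ge0 A) h6)).
  by rewrite le_eqVlt; apply/orP; left; apply/eqP; ring.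
pose B := 2 * K * A ^+ 2 * normc rho.
have B0 : 0 <= B by rewrite mulr_ge0 ?normc_ge0.
pose c1 := 2 / normc (w - w^*); pose c2 := 1 + 2 * normc w / normc (w - w^*).
have c10 : 0 <= c1 by apply: divr_ge0; rewrite ?normc_ge0.
have c20 : 0 <= c2 by rewrite addr_ge0 ?divr_ge0 ?mulr_ge0 ?normc_ge0.
exists ((c1 + c2) * B); first exact: mulr_ge0 (addr_ge0 c10 c20) B0.
move=> f g Fz.
pose e := rnorm (gam%:C%C *: f + del%:C%C *: g).
have xB : rnorm (g + w *: f) <= B * e.
  by have := zB (g + w *: f); rewrite (cayleyE zu Fz) comb rnormZ mulrA; apply.
have yB : rnorm (g + w^* *: f) <= B * e.
  by rewrite -(cayleyE zu Fz); apply: le_trans (cayley_contraction _ zu) xB.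
have [fB gB] := cayley_components w0 xB yB; rewrite -/c1 -/c2 -/e in fB gB *.
have Be : 0 <= B * e by rewrite mulr_ge0 ?rnorm_ge0.
have := mulr_ge0 c10 Be; have := mulr_ge0 c20 Be.
by split; lra.
Qed.

End Upper.

Definition uniformly_definite T := exists2 c : R, 0 < c & forall f g, T (f, g) ->
  c * (rnorm f ^+ 2 + rnorm g ^+ 2) <= `|complex.Im (dot g f)|.

(** Reformulation as the strict contractivity of the Cayley transform, for any [w]
    on the appropriate side of the real axis. *)
Lemma uniformly_definiteP w T : complex.Im w != 0 ->
  (forall f g, T (f, g) -> 0 <= complex.Im w * complex.Im (dot g f)) ->
  uniformly_definite T <-> exists2 eta : R, 0 < eta & forall f g, T (f, g) ->
    eta * rnorm (g + w *: f) <= rnorm (g + w *: f) - rnorm (g + w^* *: f).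
Proof.
move=> Imw Tw.
have w1 : 0 < `|complex.Im w| by rewrite normr_gt0.
have diff f g : T (f, g) -> rnorm (g + w *: f) ^+ 2 - rnorm (g + w^* *: f) ^+ 2
   = 4 * `|complex.Im w| * `|complex.Im (dot g f)|.
  by move=> /Tw q0; rewrite cayley_norm -!mulrA -normrM ger0_norm.
have le_xy f g : T (f, g) -> rnorm (g + w^* *: f) <= rnorm (g + w *: f).
  move=> Tfg; rewrite -(@ler_pXn2r _ 2) ?nnegrE ?rnorm_ge0 // -subr_ge0 (diff _ _ Tfg).
  by rewrite mulr_ge0 ?mulr_ge0.
split=> [[c c0 Hc]|[eta eta0 Heta]].
  pose D := 2 * (1 + normc w ^+ 2).
  have D0 : 0 < D by rewrite mulr_gt0 // ltr_wpDr // sqr_ge0.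
  exists (2 * `|complex.Im w| * c / D); first by rewrite divr_gt0 // !mulr_gt0.
  move=> f g Tfg; have := diff f g Tfg; have := Hc f g Tfg; have := le_xy f g Tfg.
  have xD : rnorm (g + w *: f) ^+ 2 <= D * (rnorm f ^+ 2 + rnorm g ^+ 2).
    have : rnorm (g + w *: f) ^+ 2 <= (rnorm g + normc w * rnorm f) ^+ 2.
      rewrite ler_pXn2r ?nnegrE ?rnorm_ge0 ?addr_ge0 ?mulr_ge0 ?rnorm_ge0 ?normc_ge0 //.
      by apply: le_trans (rnormD _ _) _; rewrite rnormZ.
    have := sqr_ge0 (rnorm g - normc w * rnorm f).
    have := sqr_ge0 (rnorm f); have := mulr_ge0 (sqr_ge0 (normc w)) (sqr_ge0 (rnorm g)).
    by rewrite sqrrB sqrrD !exprMn /D; lra.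
  set x := rnorm (g + w *: f) in xD *; set y := rnorm (g + w^* *: f).
  set im := `|complex.Im (dot g f)| => yx cim E.
  have x0 : 0 <= x := rnorm_ge0 _; have y0 : 0 <= y := rnorm_ge0 _.
  have [x00|xn] := eqVneq x 0; first by move: yx y0; rewrite x00; lra.
  have xp : 0 < x by rewrite lt_def xn.
  rewrite -(ler_pM2l xp) mulrCA -expr2 mulrAC ler_pdivrMr //.
  have h1 : c * x ^+ 2 <= D * im.
    have := ler_wpM2l (ltW c0) xD; have := ler_wpM2l (ltW D0) cim; lra.
  have h2 := ler_wpM2l (ltW w1) h1.
  have h3 : x ^+ 2 - y ^+ 2 <= 2 * (x * (x - y)).
    by have := sqr_ge0 (x - y); rewrite sqrrB; lra.
  have h4 := ler_wpM2l (ltW D0) h3; rewrite E in h4; lra.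
pose n := normc (w - w^*).
have n0 : 0 < n by rewrite normc_gt0; exact: subJ_neq0.
pose c1 := 2 / n; pose c2 := 1 + 2 * normc w / n.
have c10 : 0 <= c1 by apply: divr_ge0 => //; exact: ltW.
have c20 : 0 <= c2 by apply: addr_ge0 => //; apply: divr_ge0 (ltW n0); rewrite mulr_ge0 ?normc_ge0.
have cc0 : 0 < c1 ^+ 2 + c2 ^+ 2 + 1 by have := sqr_ge0 c1; have := sqr_ge0 c2; lra.
exists (eta / (4 * `|complex.Im w|) / (c1 ^+ 2 + c2 ^+ 2 + 1)).
  by rewrite divr_gt0 // divr_gt0 // mulr_gt0.
move=> f g Tfg; have := diff f g Tfg; have := Heta f g Tfg; have := le_xy f g Tfg.
move=> yx; have [] := cayley_components (subJ_neq0 Imw) (lexx _) yx; rewrite -/n -/c1 -/c2.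
set x := rnorm (g + w *: f); set y := rnorm (g + w^* *: f) => fx gx.
have x0 : 0 <= x := rnorm_ge0 _; have y0 : 0 <= y := rnorm_ge0 _.
set im := `|complex.Im (dot g f)| => ex E.
have f2 : rnorm f ^+ 2 <= c1 ^+ 2 * x ^+ 2.
  by rewrite -exprMn ler_pXn2r ?nnegrE ?rnorm_ge0 //; exact: mulr_ge0.
have g2 : rnorm g ^+ 2 <= c2 ^+ 2 * x ^+ 2.
  by rewrite -exprMn ler_pXn2r ?nnegrE ?rnorm_ge0 //; exact: mulr_ge0.
rewrite mulrAC ler_pdivrMr // mulrAC ler_pdivrMr ?mulr_gt0 //.
have h1 : eta * x ^+ 2 <= 4 * `|complex.Im w| * im.
  have := ler_wpM2r x0 ex; have := mulr_ge0 y0 (_ : 0 <= x - y); rewrite subr_ge0 => /(_ yx).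
  by rewrite -E !expr2; lra.
have h2 := ler_wpM2l (ltW cc0) h1.
have h3 : rnorm f ^+ 2 + rnorm g ^+ 2 <= (c1 ^+ 2 + c2 ^+ 2 + 1) * x ^+ 2.
  by have := sqr_ge0 x; lra.
have h4 := ler_wpM2l (ltW eta0) h3; lra.
Qed.

Section UpperDefinite.
Variables (w : C) (G : C -> H -> H).
Hypothesis w_upper : upper_half_plane w.
Hypothesis holoG : holomorphic_on upper_half_plane G.
Hypothesis resG : forall z, upper_half_plane z ->
  rel_inv (rel_shift (F z) (- w)) = graph (G z).

(** With [k = Th z x], the defect of [Th p] in the direction [k] bounds
    [rnorm x - rnorm k] from below. *)
Lemma definite_upper p z : upper_half_plane p -> upper_half_plane z ->
  uniformly_definite (F p) -> uniformly_definite (F z).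
Proof.
move=> pu zu; have w0 : complex.Im w != 0 by rewrite gt_eqF //; apply/upperP.
have sign u : upper_half_plane u -> forall f g, F u (f, g) -> 0 <= complex.Im w * complex.Im (dot g f).
  move=> uu f g Fu; have /upperP u0 := uu.
  have un : nonreal u by apply/nonrealP; rewrite gt_eqF.
  have := family_sign un Fu; rewrite pmulr_rge0 // => q0.
  by rewrite mulr_ge0 // ltW //; apply/upperP.
move=> /(uniformly_definiteP w0 (sign p pu)) [eta eta0 Heta].
apply/(uniformly_definiteP w0 (sign z zu)).
have [K K0 HK] := harnack_cayley w_upper holoG resG pu zu.
exists (Num.min (eta / K) 1); first by rewrite lt_min ltr01 andbT divr_gt0.
move=> f g Fz; have kE := cayleyE resG zu Fz.
set x := g + w *: f; pose k := cayley w G z x; rewrite -kE -/k.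
have x0 := rnorm_ge0 x.
have [k0|kn] := eqVneq k 0.
  by rewrite k0 rnorm0 subr0 ler_piMl // ge_min lexx orbT.
have kp : 0 < rnorm k by rewrite rnorm_gt0.
have kx : rnorm k <= rnorm x by exact: (cayley_contraction w_upper resG).
have px : eta * rnorm x <= rnorm x - rnorm (cayley w G p x).
  have [f' [g' [Fp ->]]] := cayley_onto resG x pu.
  by rewrite (cayleyE resG pu Fp); exact: Heta.
have h1 := HK x k; rewrite -/k in h1.
have h2 : eta * rnorm x * rnorm k <= normc ((rnorm x * rnorm k)%:C%C - dot (cayley w G p x) k).
  have := le_normcD ((rnorm x * rnorm k)%:C%C - dot (cayley w G p x) k) (dot (cayley w G p x) k).
  rewrite subrK normc_real ger0_norm ?mulr_ge0 ?rnorm_ge0 //.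
  have := cauchy_schwarz dot_norm (cayley w G p x) k.
  have := ler_wpM2r (rnorm_ge0 k) px; lra.
have h3 : normc ((rnorm x * rnorm k)%:C%C - dot k k) = (rnorm x - rnorm k) * rnorm k.
  rewrite (dotxx dot_norm) -rmorphB normc_real ger0_norm; first by ring.
  by rewrite expr2 -mulrBl mulr_ge0 ?rnorm_ge0 // subr_ge0.
rewrite h3 mulrA in h1.
have := le_trans h2 h1; rewrite ler_pM2r // => h4.
apply: (@le_trans _ _ (eta / K * rnorm x)); first by rewrite ler_wpM2r // ge_min lexx.
by rewrite mulrAC ler_pdivrMr // mulrC [leRHS]mulrC mulrC.
Qed.

End UpperDefinite.

(** The Cayley transforms of [F z] and of its adjoint are adjoint to each other,
    so they have the same norm; surjectivity of [F z + w] stands in for the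
    existence of the adjoint operator. *)
Lemma definite_conj z w (A : H -> H) : nonreal z -> 0 < complex.Im z * complex.Im w ->
  rel_inv (rel_shift (F z) (- w)) = graph A ->
  uniformly_definite (F z) -> uniformly_definite (F z^*).
Proof.
move=> znr zw res.
have w0 : complex.Im w != 0 by apply: contraTneq zw => ->; rewrite mulr0 ltxx.
have sign f g : F z (f, g) -> 0 <= complex.Im w * complex.Im (dot g f).
  move=> /(family_sign znr) q0; have /nonrealP z0 := znr.
  have z2 : 0 < complex.Im z ^+ 2 by rewrite lt_def sqrf_eq0 z0 sqr_ge0.
  have := mulr_ge0 (ltW zw) q0.
  rewrite (_ : complex.Im z * complex.Im w * _ = complex.Im z ^+ 2 * (complex.Im w * complex.Im (dot g f))); last by ring.
  by rewrite pmulr_rge0.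
have w0' : complex.Im w^* != 0 by move: w0; case: (w) => a b /=; rewrite oppr_eq0.
have sign' h k : F z^* (h, k) -> 0 <= complex.Im w^* * complex.Im (dot k h).
  move=> /(family_sign (nonreal_conj znr)) q0; have /nonrealP z0 := znr.
  have z2 : 0 < complex.Im z ^+ 2 by rewrite lt_def sqrf_eq0 z0 sqr_ge0.
  have := mulr_ge0 (ltW zw) q0.
  rewrite (_ : complex.Im z * complex.Im w * _ = complex.Im z ^+ 2 * (complex.Im w^* * complex.Im (dot k h))); last first.
    by case: (z) => a b; case: (w) => c d /=; ring.
  by rewrite pmulr_rge0.
have [_ onto] := resolvent_graph res.
move=> /(uniformly_definiteP w0 sign) [eta eta0 Heta].
apply/(uniformly_definiteP w0' sign'); exists (Num.min eta 1).
  by rewrite lt_min eta0 ltr01.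
move=> h k; rewrite -(nf_adjoint familyF znr) => Fh.
have -> : w^*^* = w by exact: conjcK.
pose v := k + w *: h; pose y := k + w^* *: h.
pose f := A v; pose g := v - w *: A v.
have Fz : F z (f, g) by exact: onto.
have xv : g + w *: f = v by rewrite subrK.
have adj := Fh _ _ Fz; rewrite /= in adj.
have key : dot v v = dot y (g + w^* *: f).
  transitivity (dot v (g + w *: f)); first by rewrite xv.
  move: adj; move: (f) (g) => f0 g0 adj.
  rewrite /v /y !dotDl !dotDr !dotZl !dotZr adj.
  have -> : w^*^* = w by exact: conjcK.
  by ring.
have := Heta _ _ Fz; rewrite xv -/v -/y => e1.
have := cauchy_schwarz dot_norm y (g + w^* *: f).
rewrite -key (dotxx dot_norm) normc_real ger0_norm ?sqr_ge0 // => e2.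
have v0 := rnorm_ge0 v; have y0 := rnorm_ge0 y.
have e3 : rnorm y * rnorm (g + w^* *: f) <= rnorm y * ((1 - eta) * rnorm v).
  by apply: (ler_wpM2l y0); move: e1; lra.
have [v00|vn] := eqVneq (rnorm v) 0.
  by rewrite -/v -/y v00 subr0 ler_piMl // ge_min lexx orbT.
have vp : 0 < rnorm v by rewrite lt_def vn.
have e4 : rnorm v <= (1 - eta) * rnorm y.
  by rewrite -(ler_pM2r vp) -expr2; move: e2 e3; lra.
apply: (@le_trans _ _ (eta * rnorm y)); first by rewrite ler_wpM2r // ge_min lexx.
by rewrite -/v -/y; lra.
Qed.

End Family.

(** * Invariance of the spectral properties of the family *)

Section AdjointPairs.
Context {R : realType} {H : completeNormedModType R[i]}.
Variable dot : {dot H for Num.conj}.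
Hypothesis dot_norm : norm_from_dot dot.
Local Notation C := R[i].
Implicit Types (x y f g h k : H) (z p w : C) (T S : set (H * H)).

(** Both relations are then closed, and the roles of [T] and [S] are symmetric. *)
Definition adjoint_pair T S := [/\ linear_relation T, linear_relation S,
  rel_adjoint dot S = T & rel_adjoint dot T = S].

Definition bounded_below T := exists M : R, forall f g, T (f, g) -> rnorm f <= M * rnorm g.

Definition trivial_ker T := forall h, T (h, 0) -> h = 0.

Lemma trivial_kerP T : linear_relation T -> rel_ker T = [set 0] <-> trivial_ker T.
Proof.
move=> [T0 _]; split=> [E h Th|E].
  by have : rel_ker T h by []; rewrite E.
by apply/seteqP; split=> h; [exact: E|move=> ->].
Qed.

Lemma bounded_below_trivial_ker T : bounded_below T -> trivial_ker T.
Proof.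
move=> [M TM] h /TM; rewrite rnorm0 mulr0 => h0.
by apply/eqP; rewrite -rnorm_eq0 eq_le h0 rnorm_ge0.
Qed.

Lemma in_BH_ran T : in_BH (rel_inv T) -> rel_ran T = setT.
Proof.
move=> [A _ TA]; apply/seteqP; split=> // x _; exists (A x).
have : rel_inv T (x, A x) by rewrite TA.
by [].
Qed.

Lemma bounded_below_adjoint T S : adjoint_pair T S -> trivial_ker S ->
  bounded_below T -> bounded_below S.
Proof.
move=> [Tlin Slin ST TS] S0 [M TM].
have /in_BH_ran Tran := bounded_below_in_BH dot_norm Tlin ST TS TM S0.
have [|M' _ SM] := @surjective_bounded_below _ _ dot dot_norm T S _ Slin Tran.
  by rewrite TS.
by exists M'.
Qed.

(** [T z] stands for [F z - a], for [F(z)^-1] or for [N(z,z)], and [S z] for its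
    adjoint.  The continuous spectrum needs no estimate of its own: if the range
    were everything at [z], then [S z] would be bounded below, and 0 would be in
    the resolvent set at both points. *)
Lemma spectrum_transfer (T S : C -> set (H * H)) :
  (forall z, nonreal z -> adjoint_pair (T z) (S z)) ->
  (forall z z', nonreal z -> nonreal z' -> bounded_below (S z) -> bounded_below (T z')) ->
  (forall z z', nonreal z -> nonreal z' -> trivial_ker (T z) ->
     trivial_ker (T z') /\ trivial_ker (S z')) ->
  forall z0 z, nonreal z0 -> nonreal z ->
  (in_BH (rel_inv (T z0)) -> in_BH (rel_inv (T z))) /\
  ([/\ rel_ker (T z0) = [set 0], dense (rel_ran (T z0)) & rel_ran (T z0) <> setT] ->
   [/\ rel_ker (T z) = [set 0], dense (rel_ran (T z)) & rel_ran (T z) <> setT]).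
Proof.
move=> adj bb inj z0 z z0nr znr.
have onto_bb u u' : nonreal u -> nonreal u' -> rel_ran (T u) = setT -> bounded_below (T u').
  move=> unr u'nr uran; apply: (bb u) => //; have [_ Slin _ TS] := adj u unr.
  have [|M _ SM] := @surjective_bounded_below _ _ dot dot_norm (T u) (S u) _ Slin uran.
    by rewrite TS.
  by exists M.
have bb_BH u : nonreal u -> bounded_below (T u) -> in_BH (rel_inv (T u)).
  move=> unr Tbb; have [_ Su0] := inj u u unr unr (bounded_below_trivial_ker Tbb).
  have [Tlin _ ST TS] := adj u unr; have [M TM] := Tbb.
  exact: (bounded_below_in_BH dot_norm Tlin ST TS TM Su0).
split=> [/in_BH_ran ran0|[ker0 _ ran0]]; first by apply: bb_BH => //; exact: onto_bb ran0.
have [T0lin _ _ _] := adj z0 z0nr; have [Tlin _ _ TS] := adj z znr.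
have /trivial_kerP := ker0; move=> /(_ T0lin) T00.
have [Tz0 Sz0] := inj z0 z z0nr znr T00.
split; first exact/trivial_kerP.
- exact: (dense_ran dot_norm Tlin TS Sz0).
- by move=> /(onto_bb z z0 znr z0nr)/(bb_BH _ z0nr)/in_BH_ran.
Qed.

Lemma rel_shiftE T (a : C) f g : rel_shift T a (f, g) <-> T (f, g + a *: f).
Proof.
split=> [[f' [g' [Tfg [-> ->]]]]|Tfg]; first by rewrite subrK.
by exists f, (g + a *: f); rewrite addrK.
Qed.

Lemma rel_shift0 T : rel_shift T 0 = T.
Proof. by apply/seteqP; split=> -[f g]; rewrite rel_shiftE scale0r addr0. Qed.

Lemma rel_shift_linear T (a : C) : linear_relation T -> linear_relation (rel_shift T a).
Proof.
move=> [T0 TD]; split=> [|c [f g] [f' g'] /rel_shiftE p /rel_shiftE q]; apply/rel_shiftE.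
  by rewrite scaler0 addr0.
have := TD c _ _ p q.
rewrite -[_ + _]/(c *: f + f', c *: (g + a *: f) + (g' + a *: f')).
by rewrite scalerDr scalerA mulrC -scalerA addrACA -scalerDr.
Qed.

Lemma rel_adjoint_shift T (a : R) :
  rel_adjoint dot (rel_shift T a%:C%C) = rel_shift (rel_adjoint dot T) a%:C%C.
Proof.
have aJ : (a%:C%C : C)^* = a%:C%C by exact: conjc_real.
apply/seteqP; split=> -[h k].
  move=> adj; apply/rel_shiftE => f g Tfg /=.
  have /= := adj f (g - a%:C%C *: f); rewrite dotDl dotBr dotZl dotZr aJ => ->; first by ring.
  by apply/rel_shiftE; rewrite subrK.
move=> /rel_shiftE adj f g /rel_shiftE /adj /=; rewrite dotDl dotDr dotZl dotZr aJ.
by move/addIr.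
Qed.

Lemma rel_inv_linear T : linear_relation T -> linear_relation (rel_inv T).
Proof.
move=> [T0 TD]; split=> // c [f g] [f' g'] p q; exact: (TD c _ _ p q).
Qed.

Lemma rel_adjoint_inv T : rel_adjoint dot (rel_inv T) = rel_inv (rel_adjoint dot T).
Proof.
by apply/seteqP; split=> -[h k] adj f g Tfg /=; rewrite -(adj g f Tfg).
Qed.

Lemma rel_invK T : rel_inv (rel_inv T) = T.
Proof. by apply/seteqP; split=> -[f g]. Qed.

Variable F : C -> set (H * H).
Hypothesis familyF : nevanlinna_family dot F.

Lemma neutral_everywhere z z' f g : nonreal z -> nonreal z' ->
  neutral_in dot (F z) f g -> neutral_in dot (F z') f g.
Proof.
apply: (@transport _ (fun u => neutral_in dot (F u) f g)).
  have [w wu [G hG resG]] := nf_holomorphic_upper familyF.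
  by move=> p u pu uu; exact: (neutral_upper dot_norm familyF wu hG resG).
by move=> u unr; exact: (neutral_conj familyF).
Qed.

Lemma definite_everywhere z z' : nonreal z -> nonreal z' ->
  uniformly_definite dot (F z) -> uniformly_definite dot (F z').
Proof.
apply: (@transport _ (fun u => uniformly_definite dot (F u))).
  have [w wu [G hG resG]] := nf_holomorphic_upper familyF.
  by move=> p u pu uu; exact: (definite_upper dot_norm familyF wu hG resG).
move=> u unr; have /nonrealP := unr; rewrite neq_lt => /orP[u0|u0].
  have [w wl [G hG resG]] := nf_holomorphic_lower familyF.
  apply: (definite_conj dot_norm familyF unr _ (resG u _)); last exact/lowerP.
  by rewrite nmulr_rgt0 //; apply/lowerP.
have [w wu [G hG resG]] := nf_holomorphic_upper familyF.
apply: (definite_conj dot_norm familyF unr _ (resG u _)); last exact/upperP.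
by rewrite pmulr_rgt0 //; apply/upperP.
Qed.

(** For real [a] the pair [(h, a h)] is neutral. *)
Lemma neutral_shift_ker (a : R) z z' : nonreal z -> nonreal z' ->
  rel_ker (rel_shift (F z) a%:C%C) `<=` rel_ker (rel_shift (F z') a%:C%C).
Proof.
move=> znr z'nr h /rel_shiftE; rewrite add0r => Fz; apply/rel_shiftE; rewrite add0r.
have [] // := @neutral_everywhere z z' h (a%:C%C *: h) znr z'nr.
by split=> //; rewrite dotZl (dotxx dot_norm) -rmorphM.
Qed.

Lemma adjoint_pair_shift (a : R) z : nonreal z ->
  adjoint_pair (rel_shift (F z) a%:C%C) (rel_shift (F z^*) a%:C%C).
Proof.
move=> znr; have zJ := nonreal_conj znr.
split; do ?by apply: rel_shift_linear; exact: (nf_linear familyF).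
  by rewrite rel_adjoint_shift (nf_adjoint familyF zJ) [_^*^*](@conjcK R).
by rewrite rel_adjoint_shift (nf_adjoint familyF znr).
Qed.

Lemma adjoint_pair_inv z : nonreal z -> adjoint_pair (rel_inv (F z)) (rel_inv (F z^*)).
Proof.
move=> znr; have zJ := nonreal_conj znr.
split; do ?by apply: rel_inv_linear; exact: (nf_linear familyF).
  by rewrite rel_adjoint_inv (nf_adjoint familyF zJ) [_^*^*](@conjcK R).
by rewrite rel_adjoint_inv (nf_adjoint familyF znr).
Qed.

Lemma trivial_ker_shift (a : R) z z' : nonreal z -> nonreal z' ->
  trivial_ker (rel_shift (F z) a%:C%C) -> trivial_ker (rel_shift (F z') a%:C%C).
Proof. by move=> znr z'nr z0 h /(neutral_shift_ker z'nr znr)/z0. Qed.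

Lemma trivial_ker_inv z z' : nonreal z -> nonreal z' ->
  trivial_ker (rel_inv (F z)) -> trivial_ker (rel_inv (F z')).
Proof.
move=> znr z'nr z0 g Fg; apply: z0.
have [] // := @neutral_everywhere z' z 0 g z'nr znr.
by split=> //; rewrite dot0r.
Qed.

Lemma bounded_below_shift (a : R) z z' : nonreal z -> nonreal z' ->
  bounded_below (rel_shift (F z) a%:C%C) -> bounded_below (rel_shift (F z') a%:C%C).
Proof.
apply: (@transport _ (fun u => bounded_below (rel_shift (F u) a%:C%C))).
  have combE u : comb_bounded (- a) 1 (F u) <-> bounded_below (rel_shift (F u) a%:C%C).
    split=> [[M M0 HM]|[M HM]].
      exists M => f g /rel_shiftE /HM [+ _].
      by rewrite rmorphN rmorph1 scale1r scaleNr addrC addrK.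
    have HM' f g : F u (f, g) -> rnorm f <= `|M| * rnorm (g - a%:C%C *: f).
      move=> Fu; apply: (@le_trans _ _ (M * rnorm (g - a%:C%C *: f))).
        by apply: HM; apply/rel_shiftE; rewrite subrK.
      by rewrite ler_wpM2r ?rnorm_ge0 ?ler_norm.
    exists (`|M| + 1 + `|a| * `|M|); first by rewrite !addr_ge0 // mulr_ge0.
    move=> f g /HM' fM; rewrite rmorphN rmorph1 scale1r scaleNr [- _ + g]addrC.
    have e0 := rnorm_ge0 (g - a%:C%C *: f).
    have q1 := mulr_ge0 (mulr_ge0 (normr_ge0 a) (normr_ge0 M)) e0.
    have q2 := mulr_ge0 (normr_ge0 M) e0.
    split; first by lra.
    have -> : rnorm g = rnorm ((g - a%:C%C *: f) + a%:C%C *: f) by rewrite subrK.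
    apply: le_trans (rnormD _ _) _; rewrite rnormZ normc_real.
    have := ler_wpM2l (normr_ge0 a) fM; lra.
  have [w wu [G hG resG]] := nf_holomorphic_upper familyF.
  move=> p u pu uu /combE pc; apply/combE.
  apply: (comb_bounded_upper dot_norm familyF wu hG resG _ pu uu pc).
  by apply/orP; right; exact: oner_neq0.
move=> u unr ub; apply: (bounded_below_adjoint (adjoint_pair_shift a unr) _ ub).
by apply: (trivial_ker_shift unr (nonreal_conj unr)); exact: bounded_below_trivial_ker.
Qed.

Lemma bounded_below_inv z z' : nonreal z -> nonreal z' ->
  bounded_below (rel_inv (F z)) -> bounded_below (rel_inv (F z')).
Proof.
apply: (@transport _ (fun u => bounded_below (rel_inv (F u)))).
  have combE u : comb_bounded 1 0 (F u) <-> bounded_below (rel_inv (F u)).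
    split=> [[M M0 HM]|[M HM]].
      by exists M => g f /HM [_]; rewrite rmorph1 rmorph0 scale1r scale0r addr0.
    exists (`|M| + 1) => [|f g Fu]; first by rewrite addr_ge0.
    rewrite rmorph1 rmorph0 scale1r scale0r addr0.
    have f0 := rnorm_ge0 f; have q := mulr_ge0 (normr_ge0 M) f0.
    split; first by lra.
    apply: le_trans (HM g f Fu) _.
    by have := ler_wpM2r f0 (ler_norm M); lra.
  have [w wu [G hG resG]] := nf_holomorphic_upper familyF.
  move=> p u pu uu /combE pc; apply/combE.
  apply: (comb_bounded_upper dot_norm familyF wu hG resG _ pu uu pc).
  by apply/orP; left; exact: oner_neq0.
move=> u unr ub; apply: (bounded_below_adjoint (adjoint_pair_inv unr) _ ub).
by apply: (trivial_ker_inv unr (nonreal_conj unr)); exact: bounded_below_trivial_ker.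
Qed.

End AdjointPairs.

(** * The Nevanlinna kernel *)

Section Kernel.
Context {R : realType} {H : completeNormedModType R[i]}.
Variable dot : {dot H for Num.conj}.
Hypothesis dot_norm : norm_from_dot dot.
Local Notation C := R[i].
Implicit Types (x y f g h k : H) (z p w : C) (T S : set (H * H)).

(** Positivity of the form at [x - L^-1 A x]. *)
Lemma symmetric_ge0_bound (A : H -> H) (L : R) : linear A -> 0 < L ->
  (forall x, rnorm (A x) <= L * rnorm x) ->
  (forall x y, dot (A x) y = dot x (A y)) -> (forall x, 0 <= complex.Re (dot (A x) x)) ->
  forall x, rnorm (A x) ^+ 2 <= L * complex.Re (dot (A x) x).
Proof.
move=> linA L0 AL symA A0 x.
have := A0 ((- L^-1)%:C%C *: A x + x).
rewrite linA dotDl !dotDr !dotZl !dotZr.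
have -> : dot (A (A x)) x = dot (A x) (A x) by rewrite symA.
rewrite (dotxx dot_norm).
have -> : ((- L^-1)%:C%C : C)^* = (- L^-1)%:C%C by exact: conjc_real.
have q : complex.Re (dot (A (A x)) (A x)) <= L * rnorm (A x) ^+ 2.
  apply: le_trans (le_trans (ler_norm _) (Re_le_normc _)) _.
  apply: le_trans (cauchy_schwarz dot_norm _ _) _.
  by rewrite expr2 mulrA ler_wpM2r ?rnorm_ge0.
have LL : L * L^-1 = 1 by rewrite divff // gt_eqF.
have Li : 0 < L^-1 by rewrite invr_gt0.
have q2 := ler_wpM2l (ltW Li) q; rewrite mulrA mulVf ?gt_eqF // mul1r in q2.
have E : complex.Re ((- L^-1)%:C%C * ((- L^-1)%:C%C * dot (A (A x)) (A x)) +
   (- L^-1)%:C%C * (rnorm (A x) ^+ 2)%:C%C +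
   ((- L^-1)%:C%C * (rnorm (A x) ^+ 2)%:C%C + dot (A x) x)) =
   L^-1 * (L^-1 * complex.Re (dot (A (A x)) (A x))) - 2 * (L^-1 * rnorm (A x) ^+ 2) + complex.Re (dot (A x) x).
  by case: (dot (A (A x)) _) => a b; case: (dot (A x) x) => c d /=; ring.
rewrite E => q3.
have q4 := ler_wpM2l (ltW Li) q2.
have q5 : L^-1 * rnorm (A x) ^+ 2 <= complex.Re (dot (A x) x) by lra.
by have := ler_wpM2l (ltW L0) q5; rewrite mulrA LL mul1r.
Qed.

Variables Phi Psi : C -> H -> H.
Hypothesis pairPhiPsi : nevanlinna_pair dot Phi Psi.
Variable F : C -> set (H * H).
Hypothesis familyF : nevanlinna_family dot F.
Hypothesis F_def : forall z, nonreal z -> F z = pair_family Phi Psi z.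

Local Notation N z := (nevanlinna_kernel dot Phi Psi z z).

Lemma pair_mem_family z h : nonreal z -> F z (Phi z h, Psi z h).
Proof. by move=> znr; rewrite F_def //; exists h. Qed.

Lemma Phi_bounded z : nonreal z -> bounded_operator (Phi z).
Proof. by have [+ _] := np_holomorphic_Phi pairPhiPsi; apply. Qed.

Lemma Psi_bounded z : nonreal z -> bounded_operator (Psi z).
Proof. by have [+ _] := np_holomorphic_Psi pairPhiPsi; apply. Qed.

Lemma dot_kernel z h k : nonreal z ->
  dot (N z h) k = (z - z^*)^-1 * (dot (Psi z h) (Phi z k) - dot (Phi z h) (Psi z k)).
Proof.
move=> znr; rewrite dotZl dotBl.
by rewrite (adjointP dot_norm (Phi_bounded znr)) (adjointP dot_norm (Psi_bounded znr)).
Qed.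

Lemma kernel_symmetric z h k : nonreal z -> dot (N z h) k = dot h (N z k).
Proof.
move=> znr; rewrite (dotC dot h) !dot_kernel //.
rewrite (dotC dot (Psi z k)) (dotC dot (Phi z k)) rmorphM fmorphV rmorphB /= rmorphB /=.
rewrite !(@conjCK _ _).
by rewrite -[z^* - z]opprB invrN mulNr -mulrN opprB.
Qed.

(** The form of [N(z,z)] is the form [Im <g, f>] on [F z], read through
    [(f, g) = (Phi z h, Psi z h)]. *)
Lemma kernel_Re z h : nonreal z ->
  complex.Im (dot (Psi z h) (Phi z h)) = complex.Im z * complex.Re (dot (N z h) h).
Proof.
move=> znr; have /nonrealP z0 := znr; rewrite dot_kernel // (dotC dot (Phi z h)).
have -> : z - z^* = (2 * complex.Im z)%:C%C * 'i%C.
  by case: (z) => a b; apply/eqP; rewrite eq_complex /=; apply/andP; split; apply/eqP; ring.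
have -> : dot (Psi z h) (Phi z h) - (dot (Psi z h) (Phi z h))^* =
    (2 * complex.Im (dot (Psi z h) (Phi z h)))%:C%C * 'i%C.
  by case: (dot _ _) => a b; apply/eqP; rewrite eq_complex /=; apply/andP; split; apply/eqP; ring.
have i0 : ('i%C : C) != 0 by rewrite eq_complex /= oner_eq0 andbF.
rewrite invfM mulrACA [_ * 'i%C](_ : _ = 1) ?mulVf // mulr1 -fmorphV -rmorphM /=.
by field; rewrite z0.
Qed.

Lemma kernel_Re_ge0 z h : nonreal z -> 0 <= complex.Re (dot (N z h) h).
Proof.
move=> znr; have /nonrealP z0 := znr.
have z2 : 0 < complex.Im z ^+ 2 by rewrite lt_def sqrf_eq0 z0 sqr_ge0.
have := family_sign familyF znr (pair_mem_family h znr).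
by rewrite kernel_Re // mulrA -expr2 pmulr_rge0.
Qed.

Lemma op_bound (A : H -> H) : bounded_operator A ->
  exists2 M : R, 0 <= M & forall x, rnorm (A x) <= M * rnorm x.
Proof.
move=> [_ [M /opnorm_leP AM]]; exists `|M| => // x.
by apply: le_trans (AM x) _; rewrite ler_wpM2r ?rnorm_ge0 ?ler_norm.
Qed.

Lemma dot_ext x y : (forall k, dot x k = dot y k) -> x = y.
Proof.
move=> xy; apply/eqP; rewrite -subr_eq0 -rnorm_eq0 -sqrf_eq0 -(inj_eq (@complexI _)) /=.
by rewrite -(dotxx dot_norm) dotBl xy subrr.
Qed.

Lemma kernel_linear z : nonreal z -> linear (N z).
Proof.
move=> znr a x y; apply: dot_ext => k.
have [linPhi _] := Phi_bounded znr; have [linPsi _] := Psi_bounded znr.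
rewrite dot_kernel // [RHS]dotDl [in RHS](dotZl dot a (N z x)) !dot_kernel // linPhi linPsi.
by rewrite !dotDl !dotZl; ring.
Qed.

Lemma kernel_bounded z : nonreal z ->
  exists2 L : R, 0 < L & forall x, rnorm (N z x) <= L * rnorm x.
Proof.
move=> znr.
have [M1 M10 H1] := op_bound (Phi_bounded znr); have [M2 M20 H2] := op_bound (Psi_bounded znr).
pose c := normc (z - z^*)^-1.
have c0 : 0 <= c := normc_ge0 _.
have cM : 0 <= c * (2 * M1 * M2) by rewrite !mulr_ge0.
exists (c * (2 * M1 * M2) + 1); first by lra.
move=> x; apply: (@le_trans _ _ (c * (2 * M1 * M2) * rnorm x)); last first.
  by have := rnorm_ge0 x; lra.
have [Nx|Nx] := eqVneq (rnorm (N z x)) 0; first by rewrite Nx mulr_ge0 ?rnorm_ge0.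
have Np : 0 < rnorm (N z x) by rewrite lt_def Nx rnorm_ge0.
rewrite -(ler_pM2r Np) -expr2.
have -> : rnorm (N z x) ^+ 2 = normc (dot (N z x) (N z x)).
  by rewrite (dotxx dot_norm) normc_real ger0_norm ?sqr_ge0.
rewrite dot_kernel // normcM -/c -!mulrA ler_wpM2l //.
set y := N z x.
apply: le_trans (le_normcB _ _) _.
have h1 := cauchy_schwarz dot_norm (Psi z x) (Phi z y).
have h2 := cauchy_schwarz dot_norm (Phi z x) (Psi z y).
have h3 := ler_pM (rnorm_ge0 _) (rnorm_ge0 _) (H2 x) (H1 y).
have h4 := ler_pM (rnorm_ge0 _) (rnorm_ge0 _) (H1 x) (H2 y).
lra.
Qed.

(** From the bounded inverse of [Psi + i Phi] or [Psi - i Phi]: the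
    parametrization [h |-> (Phi z h, Psi z h)] of [F z] is a homeomorphism. *)
Lemma pair_lower_bound z : nonreal z ->
  exists2 M : R, 0 <= M & forall h, rnorm h <= M * (rnorm (Phi z h) + rnorm (Psi z h)).
Proof.
have bound (K : H -> H) : resolvent_set (graph K) 0 ->
    exists2 M : R, 0 <= M & forall h, rnorm h <= M * rnorm (K h).
  rewrite /resolvent_set /= rel_shift0 => -[A /op_bound [M M0 AM] KA].
  exists M => // h; have : rel_inv (graph K) (K h, h) by [].
  by rewrite KA /graph /= => {1}->; exact: AM.
move=> /nonrealP; rewrite neq_lt => /orP[/lowerP zl|/upperP zu].
  have [M M0 HM] := bound _ (np_resolvent_lower pairPhiPsi zl).
  exists M => // h; apply: le_trans (HM h) _; rewrite ler_wpM2l //.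
  by apply: le_trans (rnormB _ _) _; rewrite rnormZ normc_i mul1r addrC.
have [M M0 HM] := bound _ (np_resolvent_upper pairPhiPsi zu).
exists M => // h; apply: le_trans (HM h) _; rewrite ler_wpM2l //.
by apply: le_trans (rnormD _ _) _; rewrite rnormZ normc_i mul1r addrC.
Qed.

Lemma adjoint_pair_kernel z : nonreal z -> adjoint_pair dot (graph (N z)) (graph (N z)).
Proof.
move=> znr; have linN := kernel_linear znr.
have lin : linear_relation (graph (N z)).
  split; first by rewrite /graph /= (linear_at0 linN).
  by move=> a [f g] [f' g']; rewrite /graph /= => -> ->; rewrite linN.
have self : rel_adjoint dot (graph (N z)) = graph (N z).
  apply/seteqP; split=> -[h k] /=.
    move=> adj; apply: dot_ext => f.
    by have /= -> := adj f (N z f) erefl; rewrite kernel_symmetric.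
  by rewrite /graph /= => -> f g /= ->; rewrite kernel_symmetric.
by split.
Qed.

(** A vector of the kernel of [N(z',z')] gives a neutral pair of [F z'], which is
    then also a pair of [F z]; there it is isotropic. *)
Lemma trivial_ker_kernel z z' : nonreal z -> nonreal z' ->
  trivial_ker (graph (N z)) -> trivial_ker (graph (N z')).
Proof.
move=> znr z'nr Nz h; rewrite /graph /= => Nh.
have q0 : complex.Im (dot (Psi z' h) (Phi z' h)) = 0.
  by rewrite kernel_Re // -Nh dot0l mulr0.
have [] := neutral_everywhere dot_norm familyF z'nr znr (conj (pair_mem_family h z'nr) q0).
rewrite {1}F_def // => -[h' [E1 E2]] q1.
have /nonrealP z0 := znr.
have iso : rel_adjoint dot (F z) (Phi z h', Psi z h').
  apply: (semidefinite_isotropic (nf_linear familyF znr) _ z0 (pair_mem_family h' znr)).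
    by move=> f g; exact: (family_sign familyF znr).
  by rewrite -E1 -E2.
have h'0 : h' = 0.
  apply: Nz; rewrite /graph /=; apply: dot_ext => k.
  rewrite dot0l dot_kernel //.
  by have /= -> := iso _ _ (pair_mem_family k znr); rewrite subrr mulr0.
have [linPhi _] := Phi_bounded znr; have [linPsi _] := Psi_bounded znr.
have [M M0 /(_ h)] := pair_lower_bound z'nr.
rewrite E1 E2 h'0 (linear_at0 linPhi) (linear_at0 linPsi) rnorm0 addr0 mulr0 => h0.
by apply/eqP; rewrite -rnorm_eq0 eq_le h0 rnorm_ge0.
Qed.

Lemma bounded_below_kernelP z : nonreal z ->
  bounded_below (graph (N z)) <-> uniformly_definite dot (F z).
Proof.
move=> znr; have /nonrealP z0 := znr.
have zn : 0 < `|complex.Im z| by rewrite normr_gt0.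
have defE h : `|complex.Im (dot (Psi z h) (Phi z h))| = `|complex.Im z| * complex.Re (dot (N z h) h).
  by rewrite kernel_Re // normrM (ger0_norm (kernel_Re_ge0 h znr)).
have [M1 M10 H1] := op_bound (Phi_bounded znr); have [M2 M20 H2] := op_bound (Psi_bounded znr).
split=> [[M HM]|[c c0 Hc]].
  have [L L0 HL] := kernel_bounded znr.
  have NL := symmetric_ge0_bound (kernel_linear znr) L0 HL
    (fun x y => kernel_symmetric x y znr) (fun x => kernel_Re_ge0 x znr).
  pose B := (M1 ^+ 2 + M2 ^+ 2) * (M ^+ 2 * L) + 1.
  have B0 : 0 < B.
    have := mulr_ge0 (addr_ge0 (sqr_ge0 M1) (sqr_ge0 M2)) (mulr_ge0 (sqr_ge0 M) (ltW L0)).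
    by rewrite /B; lra.
  exists (`|complex.Im z| / B); first by rewrite divr_gt0.
  move=> f g; rewrite F_def // => -[h [-> ->]]; rewrite defE.
  rewrite mulrAC ler_pdivrMr // -mulrA ler_pM2l //.
  have h1 : rnorm (Phi z h) ^+ 2 <= M1 ^+ 2 * rnorm h ^+ 2.
    by rewrite -exprMn ler_pXn2r ?nnegrE ?rnorm_ge0 ?mulr_ge0 ?rnorm_ge0.
  have h2 : rnorm (Psi z h) ^+ 2 <= M2 ^+ 2 * rnorm h ^+ 2.
    by rewrite -exprMn ler_pXn2r ?nnegrE ?rnorm_ge0 ?mulr_ge0 ?rnorm_ge0.
  have h3 : rnorm h <= M * rnorm (N z h) by exact: HM.
  have h4 : rnorm h ^+ 2 <= M ^+ 2 * rnorm (N z h) ^+ 2.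
    rewrite -exprMn ler_pXn2r ?nnegrE ?rnorm_ge0 //.
    exact: le_trans (rnorm_ge0 _) h3.
  have h5 := ler_wpM2l (sqr_ge0 M) (NL h).
  have h6 := ler_wpM2l (addr_ge0 (sqr_ge0 M1) (sqr_ge0 M2)) (le_trans h4 h5).
  have := kernel_Re_ge0 h znr.
  rewrite /B; lra.
have [D D0 HD] := pair_lower_bound znr.
exists (2 * D ^+ 2 * `|complex.Im z| / c) => h g; rewrite {1}/graph /= => ->.
have [->|h0] := eqVneq h 0.
  by rewrite rnorm0 mulr_ge0 ?rnorm_ge0 // divr_ge0 ?mulr_ge0 ?sqr_ge0 // ltW.
have hp : 0 < rnorm h by rewrite rnorm_gt0.
have := Hc _ _ (pair_mem_family h znr); rewrite defE => h1.
have h2 : complex.Re (dot (N z h) h) <= rnorm (N z h) * rnorm h.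
  exact: le_trans (le_trans (ler_norm _) (Re_le_normc _)) (cauchy_schwarz dot_norm _ _).
have h3 : rnorm h ^+ 2 <= 2 * D ^+ 2 * (rnorm (Phi z h) ^+ 2 + rnorm (Psi z h) ^+ 2).
  apply: (@le_trans _ _ (D ^+ 2 * (rnorm (Phi z h) + rnorm (Psi z h)) ^+ 2)).
    by rewrite -exprMn ler_pXn2r ?nnegrE ?rnorm_ge0 ?mulr_ge0 ?addr_ge0 ?rnorm_ge0.
  rewrite -[leRHS]mulrA [leRHS]mulrCA; apply: (ler_wpM2l (sqr_ge0 D)).
  by have := sqr_ge0 (rnorm (Phi z h) - rnorm (Psi z h)); rewrite sqrrB sqrrD; lra.
rewrite mulrAC ler_pdivlMr // -(ler_pM2r hp).
have h4 := ler_wpM2l (ltW c0) h3.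
have h5 := ler_wpM2l (ltW zn) h2.
have D2 : 0 <= 2 * D ^+ 2 by rewrite mulr_ge0 ?sqr_ge0.
have h6 := ler_wpM2l D2 (le_trans h1 h5).
move: h4 h6; rewrite expr2; lra.
Qed.

Lemma bounded_below_kernel z z' : nonreal z -> nonreal z' ->
  bounded_below (graph (N z)) -> bounded_below (graph (N z')).
Proof.
move=> znr z'nr /(bounded_below_kernelP znr) Dz.
by apply/(bounded_below_kernelP z'nr); exact: (definite_everywhere dot_norm familyF znr z'nr).
Qed.

End Kernel.

Theorem theorem3p9 (R : realType) (H : completeNormedModType R[i])
    (dot : {dot H for Num.conj}) (dot_norm : norm_from_dot dot)
    (H_separable : separable H)
    (Phi Psi : R[i] -> H -> H) (pairPhiPsi : nevanlinna_pair dot Phi Psi)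
    (F : R[i] -> set (H * H)) (familyF : nevanlinna_family dot F)
    (F_def : forall z, nonreal z -> F z = pair_family Phi Psi z)
    (z0 : R[i]) (z0_upper : upper_half_plane z0) (a : R) :
  let N z w := graph (nevanlinna_kernel dot Phi Psi z w) in
  (point_spectrum (N z0 z0) 0 ->
     forall z, nonreal z -> point_spectrum (N z z) 0) /\
  (continuous_spectrum (N z0 z0) 0 ->
     forall z, nonreal z -> continuous_spectrum (N z z) 0) /\
  (resolvent_set (N z0 z0) 0 ->
     forall z, nonreal z -> resolvent_set (N z z) 0) /\
  (point_spectrum (F z0) a%:C%C ->
     forall z, nonreal z -> point_spectrum (F z) a%:C%C /\
       rel_ker (rel_shift (F z) a%:C%C) = rel_ker (rel_shift (F z0) a%:C%C)) /\
  (continuous_spectrum (F z0) a%:C%C ->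
     forall z, nonreal z -> continuous_spectrum (F z) a%:C%C) /\
  (resolvent_set (F z0) a%:C%C ->
     forall z, nonreal z -> resolvent_set (F z) a%:C%C) /\
  (in_BH (F z0) -> forall z, nonreal z -> in_BH (F z)) /\
  (forall z z', nonreal z -> nonreal z' -> rel_mul (F z) = rel_mul (F z')).
Proof.
move=> N.
have z0nr : nonreal z0 by move/upperP: z0_upper => ?; apply/nonrealP; rewrite gt_eqF.
have adjN := adjoint_pair_kernel dot_norm pairPhiPsi.
have kerN := trivial_ker_kernel dot_norm pairPhiPsi familyF F_def.
have transferN z znr := @spectrum_transfer _ _ dot dot_norm (fun u => N u u) (fun u => N u u)
  (fun u unr => adjN u unr)
  (bounded_below_kernel dot_norm pairPhiPsi familyF F_def)
  (fun u u' unr u'nr k => conj (kerN u u' unr u'nr k) (kerN u u' unr u'nr k)) z0 z z0nr znr.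
have transferF z znr := @spectrum_transfer _ _ dot dot_norm
  (fun u => rel_shift (F u) a%:C%C) (fun u => rel_shift (F u^*) a%:C%C)
  (fun u unr => adjoint_pair_shift familyF a unr)
  (fun u u' unr u'nr => bounded_below_shift dot_norm familyF (nonreal_conj unr) u'nr)
  (fun u u' unr u'nr k => conj (trivial_ker_shift dot_norm familyF unr u'nr k)
     (trivial_ker_shift dot_norm familyF unr (nonreal_conj u'nr) k)) z0 z z0nr znr.
have transferI z znr := @spectrum_transfer _ _ dot dot_norm
  (fun u => rel_inv (F u)) (fun u => rel_inv (F u^*))
  (fun u unr => adjoint_pair_inv familyF unr)
  (fun u u' unr u'nr => bounded_below_inv dot_norm familyF (nonreal_conj unr) u'nr)
  (fun u u' unr u'nr k => conj (trivial_ker_inv dot_norm familyF unr u'nr k)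
     (trivial_ker_inv dot_norm familyF unr (nonreal_conj u'nr) k)) z0 z z0nr znr.
have kerF z z' : nonreal z -> nonreal z' ->
    rel_ker (rel_shift (F z) a%:C%C) = rel_ker (rel_shift (F z') a%:C%C).
  by move=> znr z'nr; apply/seteqP; split; exact: (neutral_shift_ker dot_norm familyF).
rewrite /point_spectrum /continuous_spectrum /resolvent_set /= !rel_shift0.
split=> [ker0 z znr kerz|].
  apply: ker0; rewrite rel_shift0 in kerz.
  have [lin0 _ _ _] := adjN _ z0nr; have [lin _ _ _] := adjN _ znr.
  by apply/(trivial_kerP lin0)/(kerN _ _ znr z0nr)/(trivial_kerP lin).
split=> [cont z znr|]; first by rewrite rel_shift0; have [_] := transferN z znr; apply.
split=> [res z znr|]; first by rewrite rel_shift0; have [+ _] := transferN z znr; apply.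
split=> [ker0 z znr|]; first by rewrite (kerF z z0).
split=> [cont z znr|]; first by have [_] := transferF z znr; apply.
split=> [res z znr|]; first by have [+ _] := transferF z znr; apply.
split=> [res z znr|z z' znr z'nr].
  by have [+ _] := transferI z znr; rewrite !rel_invK; apply.
suff sub u u' : nonreal u -> nonreal u' -> rel_mul (F u) `<=` rel_mul (F u').
  by apply/seteqP; split; exact: sub.
move=> unr u'nr g Fg.
have [] // := @neutral_everywhere _ _ dot dot_norm F familyF u u' 0 g unr u'nr.
by split=> //; rewrite dot0r.
Qed.
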